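(* There is an algorithm which, given a generating set $X=\{x_1,\ldots,x_t\}$ of a transitive group $G\leq \mathrm{S}_n$ together with a base $B=(\beta_1,\ldots,\beta_b)$ for $G$, computes $\mathrm{N}_{\mathrm{S}_n}(G)$ in time $2^{O(tb\log n)}$.
   Context: A base of $G\leq\mathrm{S}_n$ is a sequence of elements of $\{1,\ldots,n\}$ whose pointwise stabiliser in $G$ is trivial. Logarithms are to base $2$. Computing a group means producing a generating set for it. *)

(* Defs.v *)
From mathcomp Require Import all_boot all_fingroup.
Set Implicit Arguments. Unset Strict Implicit. Unset Printing Implicit Defensive.
Local Open Scope group_scope.

Definition is_base (n : nat) (G : {set {perm 'I_n}}) (B : seq 'I_n) : Prop :=
  'C_G([set x in B] | 'P) = 1.

(* Memory is an infinite array of natural numbers; instructions address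
   memory cells directly or indirectly.  Only addition and truncated
   subtraction are primitive (so the model is polynomially equivalent to
   Turing machines / the usual word RAM). *)
Inductive instr : Type :=
| IConst of nat & nat
| IAdd   of nat & nat & nat
| ISub   of nat & nat & nat
| ILoad  of nat & nat
| IStore of nat & nat
| IJz    of nat & nat
| IJmp   of nat
| IHalt.

Definition program := seq instr.

Record config := Config { pc : nat; memory : nat -> nat }.

Definition upd (M : nat -> nat) (a v : nat) : nat -> nat :=
  fun i => if i == a then v else M i.

Definition step (P : program) (c : config) : config :=
  let M := memory c in
  let p := pc c in
  match nth IHalt P p with
  | IConst d k => Config p.+1 (upd M d k)
  | IAdd d a b => Config p.+1 (upd M d (M a + M b))
  | ISub d a b => Config p.+1 (upd M d (M a - M b))
  | ILoad d a => Config p.+1 (upd M d (M (M a)))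
  | IStore a s => Config p.+1 (upd M (M a) (M s))
  | IJz r l => if M r == 0 then Config l M else Config p.+1 M
  | IJmp l => Config l M
  | IHalt => c
  end.

Definition is_halted (P : program) (c : config) : bool :=
  if nth IHalt P (pc c) is IHalt then true else false.

Fixpoint run (P : program) (k : nat) (c : config) : option config :=
  if is_halted P c then Some c else
  match k with
  | 0 => None
  | k'.+1 => run P k' (step P c)
  end.

Definition enc_perm (n : nat) (x : {perm 'I_n}) : seq nat :=
  [seq val (x i) | i <- enum 'I_n].

Definition enc_input (n : nat) (X : seq {perm 'I_n}) (B : seq 'I_n) : seq nat :=
  [:: n, size X, size B & flatten (map (@enc_perm n) X) ++ map val B].

Definition init_config (s : seq nat) : config :=
  Config 0 (fun i => nth 0 s i).

Definition encodes_output (n : nat) (M : nat -> nat) (Y : seq {perm 'I_n}) : Prop :=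
  size Y = M 0 /\
  forall (j : nat) (i : 'I_n), j < size Y -> val (nth 1 Y j i) = M (1 + j * n + i).

(* Main.v *)
Require Import Defs.
From mathcomp Require Import all_boot all_fingroup.
From mathcomp Require Import zify.
Set Implicit Arguments. Unset Strict Implicit. Unset Printing Implicit Defensive.

(** An element s of the normaliser of G = <x_1, ..., x_t> is determined by the
    image of one point and by the conjugates x_i^s, because G is transitive; the
    conjugates lie in G, and |G| <= n^b because G has a base of length b.  So one
    lists G by closing the identity under right multiplication by the generators,
    remembering for each new element the product that produced it, and runs
    through the at most n |G|^t choices of an image j of the point 0 and of a tuple
    (y_1, ..., y_t) in G.  For each choice the relations 0^s = j and
    (p^(x_i))^s = (p^s)^(y_i) define a map s along the list of G, and s is a
    normalising permutation with x_i^s = y_i exactly when s is injective and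
    satisfies all these relations.

    The random access machine is programmed in a small language with scalars and
    unbounded arrays.  Its weakest preconditions demand that no loop iterates more
    than Z times, which bounds the running time by Z to a power depending on the
    program only; here Z = 2^O(tb log n). *)

(** * Structured programs on the random access machine *)

(** Only the number n |G|^t of candidates has t in the exponent of |G|; listing G and testing a
    candidate cost polynomially in n, t and |G|. The obstacle is the machine. It has no
    multiplication, and the input occupies the low cells, which are also where the output must end
    up. So the input is first moved above an address that doublings alone can produce, and every row
    offset k n is obtained by repeated addition. That address contains a factor 2^t, which is
    affordable because t is at most t b log n once n > 1. Time is counted crudely: with at most Z
    passes per loop a program takes at most Z^r steps, r depending on its syntax alone, and a
    constant factor in the exponent is all that may be lost. For the same reason the output is
    simply the list of all elements of the normaliser, possibly with a repetition. *)

Fixpoint while_wp (S : Type) (Z : nat) (b : S -> bool)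
    (f : (S -> Prop) -> S -> Prop) (Q : S -> Prop) (s : S) : Prop :=
  if b s then if Z is Z'.+1 then f (while_wp Z' b f Q) s else False else Q s.

Definition monotone_wp (S : Type) (f : (S -> Prop) -> S -> Prop) : Prop :=
  forall (Q Q' : S -> Prop), (forall s, Q s -> Q' s) -> forall s, f Q s -> f Q' s.

Lemma while_wp_mono (S : Type) Z (b : S -> bool) f :
  monotone_wp f -> monotone_wp (while_wp Z b f).
Proof.
move=> fm Q Q' QQ'; elim: Z => [|Z IH] s /=; case: (b s) => //; try exact: QQ'.
exact: fm.
Qed.

(** The index k is a variant: an upper bound on the passes still to come. It drops at each pass, but
    the loop may stop early, at any k. *)
Lemma while_wp_inv (S : Type) (I : nat -> S -> Prop) Z N (b : S -> bool) f
    (Q : S -> Prop) s :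
  monotone_wp f ->
  (forall k s, I k s -> b s -> exists2 k', k = k'.+1 & f (I k') s) ->
  (forall k s, I k s -> ~~ b s -> Q s) ->
  N <= Z -> I N s -> while_wp Z b f Q s.
Proof.
move=> fm step stop; elim: Z N s => [|Z IH] N s leNZ IN /=;
  case: ifPn => [bs|/(stop _ _ IN)//]; have [k' eN fs] := step _ _ IN bs.
  by move: leNZ; rewrite eN.
by apply: (fm (I k')) fs => s'; apply: IH; rewrite eN in leNZ.
Qed.

(** Equal guards keep the two loops in lockstep, so the same fuel serves both. This transfers a loop
    on abstract states to its compiled form. *)
Lemma while_wp_sim (S T : Type) (R : S -> T -> Prop) Z b1 f1 (Q : S -> Prop)
    b2 f2 s t :
  monotone_wp f2 ->
  (forall s t, R s t -> b1 s = b2 t) ->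
  (forall Q s t, R s t -> f1 Q s ->
     f2 (fun t' => exists2 s', R s' t' & Q s') t) ->
  R s t -> while_wp Z b1 f1 Q s ->
  while_wp Z b2 f2 (fun t' => exists2 s', R s' t' & Q s') t.
Proof.
move=> fm Rb Rf; elim: Z s t => [|Z IH] s t Rst /=; rewrite -(Rb _ _ Rst);
  case: (b1 s) => // H; try by exists s.
by apply: (fm _ _ _ _ (Rf _ _ _ Rst H)) => t' [s' Rs't']; apply: IH.
Qed.

(** * Compilation of structured code into jumps *)

Inductive code : Type :=
| Skip
| Const of nat & nat
| Add of nat & nat & nat
| Sub of nat & nat & nat
| Fetch of nat & nat
| Write of nat & nat
| Seq of code & code
| If of nat & code & code
| While of nat & code.

Fixpoint compile (off : nat) (c : code) : program :=
  match c with
  | Skip => [::]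
  | Const d k => [:: IConst d k]
  | Add d a b => [:: IAdd d a b]
  | Sub d a b => [:: ISub d a b]
  | Fetch d a => [:: ILoad d a]
  | Write a s => [:: IStore a s]
  | Seq c1 c2 =>
      let s1 := compile off c1 in s1 ++ compile (off + size s1) c2
  | If r c1 c2 =>
      let s1 := compile off.+1 c1 in
      let l := off + (size s1).+2 in
      let s2 := compile l c2 in
      IJz r l :: s1 ++ IJmp (l + size s2) :: s2
  | While r c =>
      let s := compile off.+1 c in IJz r (off + (size s).+2) :: s ++ [:: IJmp off]
  end.

Notation cells := (nat -> nat) (only parsing).

(* Every loop must stop within Z iterations. *)
Fixpoint code_wp (Z : nat) (c : code) (Q : cells -> Prop) (M : cells) : Prop :=
  match c with
  | Skip => Q M
  | Const d k => Q (upd M d k)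
  | Add d a b => Q (upd M d (M a + M b))
  | Sub d a b => Q (upd M d (M a - M b))
  | Fetch d a => Q (upd M d (M (M a)))
  | Write a s => Q (upd M (M a) (M s))
  | Seq c1 c2 => code_wp Z c1 (code_wp Z c2 Q) M
  | If r c1 c2 => if M r != 0 then code_wp Z c1 Q M else code_wp Z c2 Q M
  | While r c => while_wp Z (fun M => M r != 0) (code_wp Z c) Q M
  end.

Lemma code_wp_mono Z c : monotone_wp (code_wp Z c).
Proof.
elim: c => /= [|d k|d a b|d a b|d a|a s|c1 IH1 c2 IH2|r c1 IH1 c2 IH2|r c IH] Q Q' QQ' M;
  try exact: QQ'.
- by apply: IH1 => M'; apply: IH2.
- by case: ifP => _; [apply: IH1|apply: IH2].
- exact: while_wp_mono.
Qed.

(** The exponent r of the time bound Z^r. One factor Z pays for a sum of two parts or for the two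
    jumps of a conditional. A loop pays two, since Z passes take at most Z (Z^r + 2) + 1 steps,
    which is at most Z^(r+2) as soon as Z > 3. *)
Fixpoint rank (c : code) : nat :=
  match c with
  | Seq c1 c2 => (maxn (rank c1) (rank c2)).+1
  | If _ c1 c2 => (maxn (rank c1) (rank c2)).+1
  | While _ c => (rank c).+2
  | _ => 0
  end.

Definition code_at (P : program) (off : nat) (s : program) : Prop :=
  forall i, i < size s -> nth IHalt P (off + i) = nth IHalt s i.

Lemma code_at_cat P off s1 s2 :
  code_at P off (s1 ++ s2) -> code_at P off s1 /\ code_at P (off + size s1) s2.
Proof.
move=> H; split=> i ltis.
  by rewrite H ?nth_cat ?ltis // size_cat ltn_addr.
by rewrite -addnA H ?size_cat ?ltn_add2l // nth_cat ltnNge leq_addr /= addKn.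
Qed.

Lemma code_at_cons P off x s :
  code_at P off (x :: s) -> nth IHalt P off = x /\ code_at P off.+1 s.
Proof.
move=> H; split=> [|i ltis]; first by rewrite -[off]addn0 H.
by rewrite addSnnS H.
Qed.

Lemma leq_expmax Z a b : 3 < Z -> Z ^ a <= Z ^ maxn a b /\ Z ^ b <= Z ^ maxn a b.
Proof. by move=> Z3; split; apply: leq_pexp2l; lia. Qed.

Lemma compile_correct Z P c Q off M :
  3 < Z -> code_at P off (compile off c) -> code_wp Z c Q M ->
  exists k M', [/\ k <= Z ^ rank c,
    iter k (step P) (Config off M) = Config (off + size (compile off c)) M' & Q M'].
Proof.
move=> Z3.
elim: c Q off M => /= [|d k|d a b|d a b|d a|a s|c1 IH1 c2 IH2|r c1 IH1 c2 IH2|r c IH]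
  Q off M.
- by move=> _ QM; exists 0, M; rewrite addn0.
1-5: move=> /code_at_cons[eP _] QM; eexists 1, _; split; last exact: QM;
  by rewrite //= /step /= eP addn1.
- move=> /code_at_cat[P1 P2] /(IH1 _ _ _ P1)[k1 [M1 [lek1 run1]]].
  move=> /(IH2 _ _ _ P2)[k2 [M2 [lek2 run2 QM2]]].
  exists (k2 + k1), M2; split=> //.
    have [] := leq_expmax (rank c1) (rank c2) Z3; rewrite expnS; nia.
  by rewrite iterD run1 run2 size_cat addnA.
- move=> /code_at_cons[e0 /code_at_cat[P1 /code_at_cons[e1 P2]]].
  have [H1 H2] := leq_expmax (rank c1) (rank c2) Z3.
  have Zp : 0 < Z ^ maxn (rank c1) (rank c2) by rewrite expn_gt0; lia.
  case: ifPn => [Mr|]; last rewrite negbK => /eqP Mr.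
    move=> /(IH1 _ _ _ P1)[k1 [M1 [lek1 run1 QM1]]].
    exists (k1.+2), M1; split=> //; first by rewrite expnS; nia.
    rewrite iterS -addn1 iterD /= /step /= e0 (negbTE Mr) run1 /= e1.
    by congr Config; rewrite size_cat /=; lia.
  have eo : (off.+1 + size (compile off.+1 c1)).+1 =
            off + (size (compile off.+1 c1)).+2 by lia.
  rewrite eo in P2.
  move=> /(IH2 _ _ _ P2)[k2 [M2 [lek2 run2 QM2]]].
  exists k2.+1, M2; split=> //; first by rewrite expnS; nia.
  rewrite -addn1 iterD /= {2}/step /= e0 Mr eqxx run2.
  by congr Config; rewrite size_cat /=; lia.
- move=> /code_at_cons[e0 /code_at_cat[P1 /code_at_cons[e1 _]]].
  (* Only the fuel of this loop is generalised for the induction; loops inside the body keep the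
     bound Z. Each pass adds a test and a jump back to the cost of the body. *)
  suff loop k : forall M, while_wp k (fun M => M r != 0) (code_wp Z c) Q M ->
    exists k' M', [/\ k' <= k * (Z ^ rank c + 2) + 1,
      iter k' (step P) (Config off M) =
        Config (off + (size (compile off.+1 c ++ [:: IJmp off])).+1) M' & Q M'].
    move=> /loop[k' [M' [lek' run' QM']]]; exists k', M'; split=> //.
    have Zp : 0 < Z ^ rank c by rewrite expn_gt0; lia.
    by rewrite !expnS; nia.
  have stop M0 : M0 r = 0 -> forall k, Q M0 -> exists k' M', [/\ k' <= k * (Z ^ rank c + 2) + 1,
      iter k' (step P) (Config off M0) =
        Config (off + (size (compile off.+1 c ++ [:: IJmp off])).+1) M' & Q M'].
    move=> Mr k' QM; exists 1, M0; split=> //; first by lia.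
    rewrite /= /step /= e0 Mr eqxx.
    by congr Config; rewrite size_cat /=; lia.
  elim: k => [|k IHk] {}M /=; case: ifPn => [Mr|/negPn/eqP/stop h] //; try exact: h.
  move=> /(IH _ _ _ P1)[k1 [M1 [lek1 run1]]] /IHk[k2 [M2 [lek2 run2 QM2]]].
  exists (k2 + k1.+2), M2; split=> //; first by nia.
  have s0 : step P (Config off M) = Config off.+1 M by rewrite /step /= e0 (negbTE Mr).
  rewrite iterD iterS iterSr s0 run1.
  by rewrite [step P _]/step /= e1 run2.
Qed.

Lemma step_halted P c : is_halted P c -> step P c = c.
Proof. by rewrite /is_halted /step; case: (nth _ _ _). Qed.

(** A halted configuration is a fixed point of [step], so stopping early and iterating k times give
    the same result. *)
Lemma run_iter P k c :
  is_halted P (iter k (step P) c) -> run P k c = Some (iter k (step P) c).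
Proof.
elim: k c => [|k IH] c; first by move=> /= ->.
rewrite iterSr /= => H; case: ifPn => [hc|_]; last exact: IH.
by congr Some; rewrite (step_halted hc); elim: {H IH}k => //= k <-; rewrite step_halted.
Qed.

Lemma code_run Z c Q M :
  3 < Z -> code_wp Z c Q M ->
  exists k cf, [/\ k <= Z ^ rank c, run (compile 0 c) k (Config 0 M) = Some cf
    & Q (memory cf)].
Proof.
move=> Z3 /(@compile_correct _ (compile 0 c) _ _ 0 _ Z3)[//|k [M' [lek ek QM']]].
exists k, (Config (size (compile 0 c)) M'); split=> //.
(* The program counter stands just past the last instruction, where [nth] returns its default
   [IHalt]. *)
by rewrite run_iter ek // /is_halted /= nth_default.
Qed.

(** * Programs with scalars and arrays *)

(** Roles: [aX] holds the generators and [aE] the listed group elements, row by row; [aP] and [aG]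
    hold the parent of each element and the index of the generator leading to it; [aD] holds the row
    offsets of the chosen tuple, [aQ] values of the candidate, [aO] the output. *)
Inductive arr : Type := aX | aE | aP | aG | aD | aQ | aO.

Definition arr_id (a : arr) : nat :=
  match a with aX => 0 | aE => 1 | aP => 2 | aG => 3 | aD => 4 | aQ => 5 | aO => 6 end.

Inductive expr : Type :=
| Cst of nat
| Var of nat
| Get of arr & expr
| Plus of expr & expr
| Minus of expr & expr.

Inductive cmd : Type :=
| Nop
| Assign of nat & expr
| Put of arr & expr & expr
| Then of cmd & cmd
| Ite of expr & cmd & cmd
| Loop of expr & cmd.

Notation state := ((nat -> nat) * (arr -> nat -> nat))%type (only parsing).

Definition put (h : arr -> nat -> nat) a i x : arr -> nat -> nat :=
  fun b j => if (arr_id b == arr_id a) && (j == i) then x else h b j.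

Fixpoint eval (e : expr) (s : state) : nat :=
  match e with
  | Cst k => k
  | Var v => s.1 v
  | Get a e => s.2 a (eval e s)
  | Plus e1 e2 => eval e1 s + eval e2 s
  | Minus e1 e2 => eval e1 s - eval e2 s
  end.

Fixpoint wp (Z : nat) (c : cmd) (Q : state -> Prop) (s : state) : Prop :=
  match c with
  | Nop => Q s
  | Assign v e => Q (upd s.1 v (eval e s), s.2)
  | Put a i e => Q (s.1, put s.2 a (eval i s) (eval e s))
  | Then c1 c2 => wp Z c1 (wp Z c2 Q) s
  | Ite e c1 c2 => if eval e s != 0 then wp Z c1 Q s else wp Z c2 Q s
  | Loop e c => while_wp Z (fun s => eval e s != 0) (wp Z c) Q s
  end.

Lemma wp_mono Z c : monotone_wp (wp Z c).
Proof.
elim: c => /= [|v e|a i e|c1 IH1 c2 IH2|e c1 IH1 c2 IH2|e c IH] Q Q' QQ' s;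
  try exact: QQ'.
- by apply: IH1 => M'; apply: IH2.
- by case: ifP => _; [apply: IH1|apply: IH2].
- exact: while_wp_mono.
Qed.

(** The result goes to cell d, and the cells from d on serve as a stack of temporaries. Three
    doublings replace the multiplication by 8, and cell 0 supplies the base address. *)
Fixpoint expr_code (d : nat) (e : expr) : code :=
  match e with
  | Cst k => Const d k
  | Var v => Seq (Const d (8 * v + 7)) (Seq (Add d d 0) (Fetch d d))
  | Get a e => Seq (expr_code d e)
      (Seq (Add d d d) (Seq (Add d d d) (Seq (Add d d d)
      (Seq (Const d.+1 (arr_id a)) (Seq (Add d d d.+1) (Seq (Add d d 0) (Fetch d d)))))))
  | Plus e1 e2 => Seq (expr_code d e1) (Seq (expr_code d.+1 e2) (Add d d d.+1))
  | Minus e1 e2 => Seq (expr_code d e1) (Seq (expr_code d.+1 e2) (Sub d d d.+1))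
  end.

Fixpoint expr_depth (e : expr) : nat :=
  match e with
  | Cst _ | Var _ => 1
  | Get _ e => maxn (expr_depth e) 2
  | Plus e1 e2 | Minus e1 e2 => maxn (expr_depth e1) (expr_depth e2).+1
  end.

(* Scalars and arrays are interleaved above the address bs, which is kept in
   cell 0; array cells are thus pairwise disjoint although unbounded. *)
Definition rep (bs : nat) (s : state) (M : cells) : Prop :=
  [/\ M 0 = bs, forall v, M (bs + 8 * v + 7) = s.1 v
    & forall a i, M (bs + 8 * i + arr_id a) = s.2 a i].

Lemma rep_agree bs s M M' :
  rep bs s M -> M' 0 = M 0 -> (forall x, bs <= x -> M' x = M x) -> rep bs s M'.
Proof.
by case=> M0 MV MA e0 eM; split=> [|v|a i]; rewrite ?e0 // eM //; lia.
Qed.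

Lemma arr_id_lt a : arr_id a < 7. Proof. by case: a. Qed.

Lemma expr_code_wp Z e d bs s M (Q : cells -> Prop) :
  rep bs s M -> 0 < d -> d + expr_depth e <= bs ->
  (forall M', M' d = eval e s -> (forall x, x < d \/ bs <= x -> M' x = M x) -> Q M') ->
  code_wp Z (expr_code d e) Q M.
Proof.
move=> rM; elim: e d M rM Q => /= [k|v|a e IH|e1 IH1 e2 IH2|e1 IH1 e2 IH2] d M rM Q d0 led HQ.
- apply: HQ => [|x xd]; rewrite /upd ?eqxx //; case: eqP => //; lia.
- case: rM => M0 MV MA.
  apply: HQ => [|x xd].
    by rewrite /upd !eqxx; (do !case: eqP; try lia) => *; rewrite -MV; congr M; lia.
  by rewrite /upd; case: eqP => //; lia.
- apply: (IH _ _ rM) => //; first by lia.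
  move=> M' M'd M'x; have := rep_agree rM (M'x 0 (or_introl d0)) (fun x h => M'x x (or_intror h)).
  case=> M0 MV MA.
  apply: HQ => [|x xd]; last first.
    by rewrite -M'x // /upd; do !(case: eqP => //; try lia).
  have [e1 e2] : (d == d.+1) = false /\ (0 == d) = false.
    by split; apply/eqP; lia.
  rewrite /upd !eqxx e1 e2 /= -MA M0 M'd.
  by do 2!(case: eqP => [|_]; first by lia); congr M'; lia.
- apply: (IH1 _ _ rM) => //; first by lia.
  move=> M1 M1d M1x; apply: (IH2) => //; last 1 first.
  + move=> M2 M2d M2x; apply: HQ => [|x xd].
      by rewrite /upd eqxx M2d -M1d; congr (_ + _); apply: M2x; lia.
    rewrite /upd; case: eqP => [|_]; first by lia.
    by rewrite M2x ?M1x //; lia.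
  + by apply: (rep_agree rM) => [|x h]; apply: M1x; lia.
  + by lia.
- apply: (IH1 _ _ rM) => //; first by lia.
  move=> M1 M1d M1x; apply: (IH2) => //; last 1 first.
  + move=> M2 M2d M2x; apply: HQ => [|x xd].
      by rewrite /upd eqxx M2d -M1d; congr (_ - _); apply: M2x; lia.
    rewrite /upd; case: eqP => [|_]; first by lia.
    by rewrite M2x ?M1x //; lia.
  + by apply: (rep_agree rM) => [|x h]; apply: M1x; lia.
  + by lia.
Qed.

Fixpoint cmd_code (c : cmd) : code :=
  match c with
  | Nop => Skip
  | Assign v e => Seq (expr_code 1 e)
      (Seq (Const 2 (8 * v + 7)) (Seq (Add 2 2 0) (Write 2 1)))
  | Put a i e => Seq (expr_code 1 i)
      (Seq (Add 1 1 1) (Seq (Add 1 1 1) (Seq (Add 1 1 1)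
      (Seq (Const 2 (arr_id a)) (Seq (Add 1 1 2) (Seq (Add 1 1 0)
      (Seq (expr_code 2 e) (Write 1 2))))))))
  | Then c1 c2 => Seq (cmd_code c1) (cmd_code c2)
  | Ite e c1 c2 => Seq (expr_code 1 e) (If 1 (cmd_code c1) (cmd_code c2))
  | Loop e c => Seq (expr_code 1 e) (While 1 (Seq (cmd_code c) (expr_code 1 e)))
  end.

Fixpoint cmd_depth (c : cmd) : nat :=
  match c with
  | Nop => 0
  | Assign _ e => maxn (expr_depth e) 2
  | Put _ i e => (maxn (maxn (expr_depth i) (expr_depth e)) 2).+1
  | Then c1 c2 => maxn (cmd_depth c1) (cmd_depth c2)
  | Ite e c1 c2 => maxn (expr_depth e) (maxn (cmd_depth c1) (cmd_depth c2))
  | Loop e c => maxn (expr_depth e) (cmd_depth c)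
  end.

Lemma cmd_code_wp Z c bs s M (Q : state -> Prop) :
  rep bs s M -> cmd_depth c < bs -> wp Z c Q s ->
  code_wp Z (cmd_code c) (fun M' => exists2 s', rep bs s' M' & Q s') M.
Proof.
elim: c s M Q => /= [|v e|a i e|c1 IH1 c2 IH2|e c1 IH1 c2 IH2|e c IH] s M Q rM dc H.
- by exists s.
- apply: (expr_code_wp _ rM) => //; first by lia.
  move=> M1 M1d M1x.
  have [M0 MV MA] : rep bs s M1 by apply: (rep_agree rM) => *; apply: M1x; lia.
  eexists; last exact: H.
  split=> [|w|b j] /=; rewrite /upd /=.
  + by case: eqP => [|_]; first lia.
  + rewrite M0 M1d; case: eqP; case: eqP => //; try lia.
    by case: eqP => [|_ _ _]; [lia|apply: MV].
  + case: eqP => [|_]; first by have := arr_id_lt b; lia.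
    by case: eqP => [|_]; [lia|apply: MA].
- apply: (expr_code_wp _ rM) => //; first by lia.
  move=> M1 M1d M1x /=.
  have [M0 MV MA] : rep bs s M1 by apply: (rep_agree rM) => *; apply: M1x; lia.
  set M2 := upd (upd _ _ _) 1 _.
  have M2x x : x = 0 \/ bs <= x -> M2 x = M1 x.
    by move=> hx; rewrite /M2 /upd; do !(case: eqP => [?|_]; first by lia).
  have M21 : M2 1 = bs + 8 * eval i s + arr_id a.
    by rewrite /M2 /upd /= M0 M1d; lia.
  have rM2 : rep bs s M2.
    by apply: (rep_agree (M := M1)) => // *; apply: M2x; lia.
  apply: (expr_code_wp _ rM2) => //; first by lia.
  move=> M3 M3d M3x.
  have [M30 M3V M3A] : rep bs s M3 by apply: (rep_agree rM2) => *; apply: M3x; lia.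
  eexists; last exact: H.
  rewrite (M3x 1) ?M21 ?M3d; last by left.
  have := arr_id_lt a => la.
  split=> [|w|b j] /=; rewrite /upd /put /=.
  + by case: eqP => [|_]; first lia.
  + by case: eqP => [|_]; first lia.
  + have := arr_id_lt b => lb.
    case: eqP => h; case: andP => // h'; first by case: h'; split; apply/eqP; lia.
    by case: h' => /eqP h1 /eqP h2; lia.
- apply: (code_wp_mono _ (IH1 _ _ _ rM _ H)); last by lia.
  by move=> M1 [s1 r1]; apply: IH2 => //; lia.
- apply: (expr_code_wp _ rM) => //; first by lia.
  move=> M1 M1d M1x /=; rewrite M1d.
  have r1 : rep bs s M1 by apply: (rep_agree rM) => *; apply: M1x; lia.
  by case: ifP H => _ H; [apply: IH1 H|apply: IH2 H] => //; lia.
- apply: (expr_code_wp _ rM) => //; first by lia.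
  move=> M1 M1d M1x /=.
  have r1 : rep bs s M1 by apply: (rep_agree rM) => *; apply: M1x; lia.
  (* The compiled loop tests a cell, not an expression, so the simulation also records that cell 1
     holds the current value of the guard. *)
  pose R s M := rep bs s M /\ M 1 = eval e s.
  have Rs : R s M1 by [].
  have Cm := @code_wp_mono Z (Seq (cmd_code c) (expr_code 1 e)).
  apply: while_wp_mono (while_wp_sim Cm _ _ Rs H) => //.
  + by move=> M' [s' [r' _] Qs']; exists s'.
  + by move=> s' M' [_ ->].
  + move=> Q' s' M' [r' _] H' /=.
    apply: (code_wp_mono _ (IH _ _ _ r' _ H')); last by lia.
    move=> M2 [s2 r2 Q2]; apply: (expr_code_wp _ r2) => //; first by lia.
    move=> M3 M3d M3x; exists s2 => //; split=> //.
    by apply: (rep_agree r2) => *; apply: M3x; lia.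
Qed.

(** * Relocating the input and the output *)

Lemma upd_same M d v : upd M d v d = v.
Proof. by rewrite /upd eqxx. Qed.

Lemma upd_other M d v x : x <> d -> upd M d v x = M x.
Proof. by rewrite /upd => /eqP/negbTE ->. Qed.

Definition block : seq code -> code := foldr Seq Skip.

Section Steps.
Variables (Z : nat) (c : code) (Q : cells -> Prop) (M : cells).

(** These rules introduce each new memory as a variable with a defining equation, so that goals do
    not fill up with nested updates. *)
Lemma const_wp d k :
  (forall M', M' = upd M d k -> code_wp Z c Q M') -> code_wp Z (Seq (Const d k) c) Q M.
Proof. by move=> H; apply: H. Qed.

Lemma add_wp d a b :
  (forall M', M' = upd M d (M a + M b) -> code_wp Z c Q M') ->
  code_wp Z (Seq (Add d a b) c) Q M.
Proof. by move=> H; apply: H. Qed.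

Lemma sub_wp d a b :
  (forall M', M' = upd M d (M a - M b) -> code_wp Z c Q M') ->
  code_wp Z (Seq (Sub d a b) c) Q M.
Proof. by move=> H; apply: H. Qed.

Lemma load_wp d a :
  (forall M', M' = upd M d (M (M a)) -> code_wp Z c Q M') ->
  code_wp Z (Seq (Fetch d a) c) Q M.
Proof. by move=> H; apply: H. Qed.

Lemma store_wp a s :
  (forall M', M' = upd M (M a) (M s) -> code_wp Z c Q M') ->
  code_wp Z (Seq (Write a s) c) Q M.
Proof. by move=> H; apply: H. Qed.

Lemma skip_wp : Q M -> code_wp Z Skip Q M.
Proof. by []. Qed.

Lemma if_wp r c1 c2 :
  (M r <> 0 -> code_wp Z c1 Q M) -> (M r = 0 -> code_wp Z c2 Q M) ->
  code_wp Z (If r c1 c2) Q M.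
Proof. by move=> H1 H2 /=; case: eqP. Qed.

Lemma seq_wp c1 (P : cells -> Prop) :
  code_wp Z c1 P M -> (forall M', P M' -> code_wp Z c Q M') ->
  code_wp Z (Seq c1 c) Q M.
Proof. by move=> H HP; apply: (code_wp_mono HP). Qed.

End Steps.
Arguments if_wp {Z Q M r c1 c2} _ _.
Arguments skip_wp {Z Q M} _.

Lemma whileR_wp Z I N r b c (Q : cells -> Prop) M :
  N <= Z -> I N M ->
  (forall k M, I k M -> M r <> 0 -> exists2 k', k = k'.+1 & code_wp Z b (I k') M) ->
  (forall k M, I k M -> M r = 0 -> code_wp Z c Q M) ->
  code_wp Z (Seq (While r b) c) Q M.
Proof.
move=> NZ IN step stop; apply: (while_wp_inv (I := I)) IN => //.
- exact: code_wp_mono.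
- by move=> k M' IkM' /eqP; apply: step.
- by move=> k M' IkM' /negPn/eqP; apply: stop IkM'.
Qed.

Opaque code_wp.

Ltac memory_at :=
  repeat match goal with
  | H : ?M = upd _ _ _ |- context [?M _] => rewrite H; rewrite /upd /=
  end.

(** The target is entry i of [aX], and cell 1 is the only scratch cell. Five such copies free the
    cells 3 to 7, which the copying loop needs as registers. *)
Definition save_cell (i : nat) : code :=
  block [:: Const 1 (8 * i); Add 1 1 0; Write 1 (3 + i)].

Arguments save_cell : simpl never.

(* Only the cells 0, 1, 2 may be overwritten before the low part of the input
   has been saved.  Packing n and t into (2n+1) 2^(t+5) frees a cell and yields
   an address beyond the generators, from which n and t can be recovered. *)
Definition boot : code := block
  [:: Add 0 0 0; Add 0 0 2; Add 0 0 0; Add 0 0 0; Add 0 0 0; Add 0 0 0; Add 0 0 0;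
      While 1 (block [:: Add 0 0 0; Sub 1 1 2]);
      save_cell 0; save_cell 1; save_cell 2; save_cell 3; save_cell 4;
      Const 3 1; Const 6 8; Const 1 8; Const 2 40; Add 2 2 0; Sub 4 0 1;
      While 4 (block [:: Fetch 5 1; Write 2 5; Add 1 1 3; Add 2 2 6; Sub 4 0 1]);
      Const 1 7; Add 1 1 0; Write 1 0].

(** The bound [lo] is the first input cell still intact: 3 at the start, 8 once the registers of the
    copying loop are in use. *)
Definition saved (lo bs i : nat) (M M' : cells) : Prop :=
  [/\ M' 0 = bs, forall x, lo <= x < bs -> M' x = M x
    & forall j, j < i -> M' (bs + 8 * j) = M (3 + j)].

Lemma save_cell_wp Z bs i c M M' (Q : cells -> Prop) :
  3 + i < bs -> saved 3 bs i M M' ->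
  (forall M'', saved 3 bs i.+1 M M'' -> code_wp Z c Q M'') ->
  code_wp Z (Seq (save_cell i) c) Q M'.
Proof.
move=> ib [M0 Mx Mj] HQ.
suff : code_wp Z (save_cell i) (code_wp Z c Q) M' by [].
refine (const_wp _) => Ma Ea; refine (add_wp _) => Mb Eb; refine (store_wp _) => Mc Ec.
refine (skip_wp _); apply: HQ.
rewrite Ec Eb Ea upd_same (upd_other _ _ (x := 0)) // upd_same M0.
split=> [|x xb|j ji].
- by rewrite !upd_other //; lia.
- by rewrite !upd_other ?Mx //; lia.
- have [->|ne] := eqVneq j i.
    by rewrite [8 * i + bs]addnC upd_same !upd_other ?Mx //; lia.
  by rewrite !upd_other ?Mj //; lia.
Qed.

Lemma boot_wp Z n t bs M :
  (2 * n + 1) * 2 ^ (t + 5) = bs ->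
  M 0 = n -> M 1 = t -> M 2 = 1 -> 0 < n -> bs <= Z ->
  code_wp Z boot (fun M' => exists2 s, rep bs s M' &
    s.1 0 = bs /\ forall i, 3 + i < bs -> s.2 aX i = M (3 + i)) M.
Proof.
move=> E M0 M1 M2 n0 bsZ.
have t0 : 0 < 2 ^ t by rewrite expn_gt0.
have bs32 : 32 < bs by rewrite -E expnD; nia.
have tbs : t <= bs.
  by have := ltn_expl t (isT : 1 < 2); rewrite -E expnD; nia.
rewrite /boot [block]lock /= -lock.
refine (add_wp _) => Ma Ea; refine (add_wp _) => Mb Eb; refine (add_wp _) => Mc Ec.
refine (add_wp _) => Md Ed; refine (add_wp _) => Me Ee; refine (add_wp _) => Mf Ef.
refine (add_wp _) => Mg Eg.
have [G0 G1 G2] : [/\ Mg 0 * 2 ^ t = bs, Mg 1 = t & Mg 2 = 1].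
  by split; memory_at; rewrite ?M0 ?M1 ?M2 //; rewrite -E expnD; lia.
have Gx x : 2 < x -> Mg x = M x by case: x => [|[|[|x]]] // _; memory_at.
move: Ea Eb Ec Ed Ee Ef Eg => _ _ _ _ _ _ _.
(* With k doublings left, the product with 2^k is the final address throughout. *)
pose I k M' := [/\ M' 1 = k, M' 0 * 2 ^ k = bs, M' 2 = 1 & forall x, 2 < x -> M' x = M x].
refine (whileR_wp (I := I) (N := t) _ _ _ _); first by lia.
  by split.
  move=> k M' [M1' M0' M2' Mx']; rewrite M1'; case: k M1' M0' => // k M1' M0' _; exists k => //.
  refine (add_wp _) => M3 E3; refine (sub_wp _) => M4 E4; refine (skip_wp _); split.
  - by memory_at; rewrite M1' M2'; lia.
  - by memory_at; rewrite -M0' expnS; lia.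
  - by memory_at; rewrite M2'.
  - by move=> x x2; rewrite E4 E3 !upd_other ?Mx' //; lia.
move=> k M' [M1' M0' M2' Mx']; rewrite M1' => k0.
have s0 : saved 3 bs 0 M M'.
  by split=> [|x xb|//]; [rewrite -M0' k0 muln1 | apply: Mx'; lia].
have low i : i < 5 -> 3 + i < bs by lia.
clear Ma Mb Mc Md Me Mf.
refine (save_cell_wp _ s0 _); [exact: low|move=> Ma sa].
refine (save_cell_wp _ sa _); [exact: low|move=> Mb sb].
refine (save_cell_wp _ sb _); [exact: low|move=> Mc sc].
refine (save_cell_wp _ sc _); [exact: low|move=> Md sd].
refine (save_cell_wp _ sd _); [exact: low|move=> Me [Me0 Mex Mej]].
move: sa sb sc sd s0 M0' M1' M2' Mx' G0 G1 G2 Gx => _ _ _ _ _ _ _ _ _ _ _ _ _.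
clear Ma Mb Mc Md Mg M'.
refine (const_wp _) => Ma Ea; refine (const_wp _) => Mb Eb; refine (const_wp _) => Mc Ec.
refine (const_wp _) => Md Ed; refine (add_wp _) => Mf Ef; refine (sub_wp _) => Mg Eg.
(* Here i entries of [aX] are in place. The count starts at 5, after the cells saved one by one, and
   ends when the next source cell 3 + i is the base address. *)
pose J k M' := exists i, [/\ saved 8 bs i M M', i + k + 3 = bs, 5 <= i &
  [/\ M' 1 = 3 + i, M' 2 = bs + 8 * i, M' 3 = 1, M' 4 = k & M' 6 = 8]].
refine (whileR_wp (I := J) (N := bs - 8) _ _ _ _); first by lia.
- have Mgx x : 7 < x -> Mg x = Me x.
    by move=> x6; rewrite Eg Ef Ed Ec Eb Ea !upd_other //; lia.
  exists 5; split=> //; try lia.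
    split=> [|x xb|j j5]; first by memory_at.
      by rewrite Mgx ?Mex //; lia.
    by rewrite Mgx ?Mej //; lia.
  by split; memory_at; rewrite ?Me0; lia.
- move=> [|k'] Ms [i [[Ms0 Msx Msj] ik i5 [R1 R2 R3 R4 R6]]]; rewrite R4 // => _.
  exists k' => //.
  refine (load_wp _) => M5 E5; refine (store_wp _) => Mt Et.
  have e2 : M5 2 = bs + 8 * i by rewrite E5 upd_other.
  have e5 : M5 5 = M (3 + i) by rewrite E5 upd_same R1 Msx //; lia.
  rewrite e2 e5 in Et.
  have Mtx x : x < bs -> x <> 5 -> Mt x = Ms x.
    by move=> xb x5; rewrite Et E5 !upd_other //; lia.
  refine (add_wp _) => Mu1 U1; refine (add_wp _) => Mu2 U2; refine (sub_wp _) => Mu U.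
  refine (skip_wp _).
  have Mux x : 6 < x -> Mu x = Mt x.
    by move=> x6; rewrite U U2 U1 !upd_other //; lia.
  exists i.+1; split=> //; try lia.
    split=> [|x xb|j ji].
    + by rewrite U U2 U1 !upd_other ?Mtx //; lia.
    + by rewrite Mux ?Mtx ?Msx //; lia.
    rewrite Mux; last by lia.
    rewrite Et; have [->|ne] := eqVneq j i; first by rewrite upd_same.
    by rewrite E5 !upd_other ?Msj //; lia.
  by split; rewrite U U2 U1 /upd /= !Mtx ?R1 ?R2 ?R3 ?R4 ?R6 ?Ms0 //; lia.
move=> k' Ms [i [[Ms0 Msx Msj] ik i5 [R1 R2 R3 R4 R6]]]; rewrite R4 => k0'.
refine (const_wp _) => M3 E3; refine (add_wp _) => M4 E4; refine (store_wp _) => M5 E5.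
refine (skip_wp _).
have e1 : M4 1 = bs + 7 by memory_at; rewrite Ms0; lia.
have e0 : M4 0 = bs by memory_at.
rewrite e0 e1 in E5.
(* The abstract state is read off the memory. Apart from scalar 0 and the copied part of [aX], its
   initial values are unspecified. *)
exists (fun v => M5 (bs + 8 * v + 7), fun a i => M5 (bs + 8 * i + arr_id a)).
  by split=> //; rewrite E5 upd_other //; lia.
split=> /= [|j jb].
  by rewrite muln0 addn0 E5 upd_same.
by rewrite addn0 E5 E4 E3 !upd_other ?Msj //; lia.
Qed.

Definition move_cell (i : nat) : code :=
  block [:: Const i (8 * i); Add i i 0; Fetch i i].

Arguments move_cell : simpl never.

(* The output is copied downwards in ascending order, so no entry is overwritten
   before it is read, except possibly the first eight: these must have been
   duplicated behind the output, and are fetched last, each cell holding the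
   address of its own final value. *)
Definition finish (v : nat) : code := block
  [:: Const 1 (8 * v + 7); Add 1 1 0; Fetch 1 1;
      Const 2 8; Const 3 70; Add 3 3 0; Const 5 1; Const 6 8; Sub 4 1 2;
      While 4 (block [:: Fetch 7 3; Write 2 7; Add 2 2 5; Add 3 3 6; Sub 4 1 2]);
      Add 1 1 1; Add 1 1 1; Add 1 1 1; Add 0 0 1; Const 1 6; Add 0 0 1;
      move_cell 1; move_cell 2; move_cell 3; move_cell 4; move_cell 5; move_cell 6;
      move_cell 7; Fetch 0 0].

Definition moved (i : nat) (f M M' : cells) : Prop :=
  [/\ M' 0 = M 0, forall j, 0 < j < i -> M' j = f j & forall x, 8 <= x -> M' x = M x].

Lemma move_cell_wp Z i c f M M' (Q : cells -> Prop) :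
  0 < i < 8 -> 8 <= M 0 -> M (M 0 + 8 * i) = f i -> moved i f M M' ->
  (forall M'', moved i.+1 f M M'' -> code_wp Z c Q M'') ->
  code_wp Z (Seq (move_cell i) c) Q M'.
Proof.
move=> i8 M0 Mi [J0 Jj Jx] HQ.
suff : code_wp Z (move_cell i) (code_wp Z c Q) M' by [].
refine (const_wp _) => Ma Ea; refine (add_wp _) => Mb Eb; refine (load_wp _) => Mc Ec.
have ei : Mb i = M 0 + 8 * i.
  by rewrite Eb upd_same Ea upd_same upd_other ?J0; lia.
refine (skip_wp _); apply: HQ; rewrite ei in Ec; split=> [|j ji|x x8].
- by rewrite Ec Eb Ea !upd_other //; lia.
- rewrite Ec; have [->|ne] := eqVneq j i.
    by rewrite upd_same Eb Ea !upd_other ?Jx ?Mi //; lia.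
  by rewrite Eb Ea !upd_other ?Jj //; lia.
- by rewrite Ec Eb Ea !upd_other ?Jx //; lia.
Qed.

Lemma finish_wp Z v bs s M :
  rep bs s M -> 8 <= bs -> s.1 v <= Z -> (forall i, i < 8 -> s.2 aO (s.1 v + i) = s.2 aO i) ->
  code_wp Z (finish v) (fun M' => forall i, i < s.1 v -> M' i = s.2 aO i) M.
Proof.
move=> [M0 MV MA] bs8 lZ dup.
have MO i : M (bs + 8 * i + 6) = s.2 aO i by apply: (MA aO).
move: (s.1 v) (MV v) lZ dup => l Ml lZ dup.
rewrite /finish [block]lock /= -lock.
refine (const_wp _) => Ma Ea; refine (add_wp _) => Mb Eb; refine (load_wp _) => Mc Ec.
have C1 : Mc 1 = l.
  have e1 : Mb 1 = bs + 8 * v + 7 by rewrite Eb /upd /= Ea /upd /= M0; lia.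
  by rewrite Ec upd_same e1 Eb Ea !upd_other ?Ml //; lia.
have Cx x : x <> 1 -> Mc x = M x by move=> x1; rewrite Ec Eb Ea !upd_other.
move: Ea Eb Ec => _ _ _; clear Ma Mb.
refine (const_wp _) => Md Ed; refine (const_wp _) => Me Ee; refine (add_wp _) => Mf Ef.
refine (const_wp _) => Mg Eg; refine (const_wp _) => Mh Eh; refine (sub_wp _) => Mi Ei.
(* The maximum with 8 covers short outputs, for which the loop makes no pass. *)
pose J k M' := exists i, [/\ M' 0 = bs, maxn l 8 = i + k, 8 <= i,
  [/\ M' 1 = l, M' 2 = i, M' 3 = bs + 8 * i + 6, M' 4 = l - i & M' 5 = 1 /\ M' 6 = 8] &
  (forall x, 8 <= x < i -> M' x = s.2 aO x) /\ (forall x, 8 <= x -> i <= x -> M' x = M x)].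
refine (whileR_wp (I := J) (N := l - 8) _ _ _ _); first by lia.
- exists 8; split=> //; try lia.
  + by memory_at; rewrite Cx.
  + by split; last (split; memory_at); memory_at; rewrite ?C1 ?Cx //; lia.
  + split=> x x8; first by lia.
    by rewrite Ei Eh Eg Ef Ee Ed !upd_other ?Cx //; lia.
- move=> k Ms [i [R0 ik i8 [R1 R2 R3 R4 [R5 R6]] [Mlt Mge]]]; rewrite R4 => li.
  case: k ik => [|k] ik; first by lia.
  exists k => //.
  refine (load_wp _) => M7 E7; refine (store_wp _) => Mt Et.
  have e2 : M7 2 = i by rewrite E7 upd_other.
  have e7 : M7 7 = s.2 aO i by rewrite E7 upd_same R3 Mge ?MO //; lia.
  rewrite e2 e7 in Et.
  have Mtx x : x < 7 -> Mt x = Ms x.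
    by move=> x7; rewrite Et E7 !upd_other //; lia.
  refine (add_wp _) => Mu1 U1; refine (add_wp _) => Mu2 U2; refine (sub_wp _) => Mu U.
  refine (skip_wp _).
  have Mux x : 6 < x -> Mu x = Mt x.
    by move=> x6; rewrite U U2 U1 !upd_other //; lia.
  exists i.+1; split=> //; try lia.
  + by rewrite U U2 U1 !upd_other ?Mtx.
  + by split; last (split; rewrite U U2 U1 /upd /= Mtx //);
      rewrite U U2 U1 /upd /= ?Mtx //; lia.
  + split=> x x8; [|move=> ix]; rewrite Mux ?Et; try lia.
      have [->|ne] := eqVneq x i; first by rewrite upd_same.
      by rewrite E7 !upd_other ?Mlt //; lia.
    by rewrite E7 !upd_other ?Mge //; lia.
move=> k Ms [i [R0 ik i8 [R1 R2 R3 R4 [R5 R6]] [Mlt Mge]]]; rewrite R4 => li.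
move: Ed Ee Ef Eg Eh Ei => _ _ _ _ _ _; clear Md Me Mf Mg Mh Mi.
refine (add_wp _) => Ma Ea; refine (add_wp _) => Mb Eb; refine (add_wp _) => Md Ed.
refine (add_wp _) => Me Ee; refine (const_wp _) => Mf Ef; refine (add_wp _) => Mg Eg.
have Mg0 : Mg 0 = bs + 8 * l + 6 by memory_at; rewrite R0 R1; lia.
have Mgx x : 1 < x -> Mg x = Ms x.
  by move=> x1; rewrite Eg Ef Ee Ed Eb Ea !upd_other //; lia.
have Mgj j : j < 8 -> Mg (Mg 0 + 8 * j) = s.2 aO j.
  move=> j8; rewrite Mg0 Mgx; last by lia.
  (* Entry l + j is the duplicate of entry j; unlike the original, it lies beyond every cell that
     the copying has written. *)
  have -> : bs + 8 * l + 6 + 8 * j = bs + 8 * (l + j) + 6 by lia.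
  by rewrite Mge ?MO ?dup //; lia.
have Mg8 : 8 <= Mg 0 by lia.
have m1 : moved 1 (s.2 aO) Mg Mg by split=> // j; lia.
move: Ea Eb Ed Ee Ef Eg => _ _ _ _ _ _; clear Ma Mb Md Me Mf.
refine (move_cell_wp _ Mg8 (Mgj 1 _) m1 _); [by []|by []|move=> Ma ma].
refine (move_cell_wp _ Mg8 (Mgj 2 _) ma _); [by []|by []|move=> Mb mb].
refine (move_cell_wp _ Mg8 (Mgj 3 _) mb _); [by []|by []|move=> Mh mh].
refine (move_cell_wp _ Mg8 (Mgj 4 _) mh _); [by []|by []|move=> Md md].
refine (move_cell_wp _ Mg8 (Mgj 5 _) md _); [by []|by []|move=> Me me].
refine (move_cell_wp _ Mg8 (Mgj 6 _) me _); [by []|by []|move=> Mf mf].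
refine (move_cell_wp _ Mg8 (Mgj 7 _) mf _); [by []|by []|move=> M' [J0 Jj Jx]].
refine (load_wp _) => Mr Er; refine (skip_wp _) => x xl; rewrite {}Er J0.
have [->|x0] := eqVneq x 0.
  by rewrite upd_same Jx // -(Mgj 0) // muln0 addn0.
rewrite upd_other; last exact/eqP.
have [x8|x8] := ltnP x 8; first by apply: Jj; lia.
by rewrite Jx // Mgx ?Mlt //; lia.
Qed.

(** * Proof rules for array programs *)

Fixpoint set_vars (c : cmd) : seq nat :=
  match c with
  | Assign v _ => [:: v]
  | Then c1 c2 | Ite _ c1 c2 => set_vars c1 ++ set_vars c2
  | Loop _ c => set_vars c
  | _ => [::]
  end.

Fixpoint put_arrs (c : cmd) : seq nat :=
  match c with
  | Put a _ _ => [:: arr_id a]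
  | Then c1 c2 | Ite _ c1 c2 => put_arrs c1 ++ put_arrs c2
  | Loop _ c => put_arrs c
  | _ => [::]
  end.

Definition frame (vs ars : seq nat) (s s' : state) : Prop :=
  (forall v, v \notin vs -> s'.1 v = s.1 v) /\
  (forall a j, arr_id a \notin ars -> s'.2 a j = s.2 a j).

Lemma frame_refl vs ars s : frame vs ars s s.
Proof. by split. Qed.

Lemma frame_trans vs ars s1 s2 s3 :
  frame vs ars s1 s2 -> frame vs ars s2 s3 -> frame vs ars s1 s3.
Proof.
by move=> [V A] [V' A']; split=> [v hv|a j ha]; [rewrite V' ?V | rewrite A' ?A].
Qed.

(** Allowing any supersets of the written variables and arrays lets both halves of a sequence, and
    all passes of a loop, share one transitive relation. *)
Lemma wp_frame_sub Z c vs ars (Q : state -> Prop) s :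
  {subset set_vars c <= vs} -> {subset put_arrs c <= ars} ->
  wp Z c Q s -> wp Z c (fun s' => frame vs ars s s' /\ Q s') s.
Proof.
elim: c Q s => /= [|v e|a i e|c1 IH1 c2 IH2|e c1 IH1 c2 IH2|e c IH] Q s sV sA.
- by split=> //; apply: frame_refl.
- split=> //; split=> //= w wv; rewrite upd_other // => ew.
  by move: wv; rewrite ew sV ?mem_head.
- split=> //; split=> //= b j bA; rewrite /put; case: eqP => //= eb.
  by move: bA; rewrite eb sA ?mem_head.
- have sV1 : {subset set_vars c1 <= vs} by move=> x h; rewrite sV ?mem_cat ?h.
  have sV2 : {subset set_vars c2 <= vs} by move=> x h; rewrite sV ?mem_cat ?h ?orbT.
  have sA1 : {subset put_arrs c1 <= ars} by move=> x h; rewrite sA ?mem_cat ?h.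
  have sA2 : {subset put_arrs c2 <= ars} by move=> x h; rewrite sA ?mem_cat ?h ?orbT.
  move=> /(IH1 _ _ sV1 sA1); apply: wp_mono => s1 [F1] /(IH2 _ _ sV2 sA2).
  by apply: wp_mono => s2 [F2 Q2]; split=> //; apply: frame_trans F2.
- have sV1 : {subset set_vars c1 <= vs} by move=> x h; rewrite sV ?mem_cat ?h.
  have sV2 : {subset set_vars c2 <= vs} by move=> x h; rewrite sV ?mem_cat ?h ?orbT.
  have sA1 : {subset put_arrs c1 <= ars} by move=> x h; rewrite sA ?mem_cat ?h.
  have sA2 : {subset put_arrs c2 <= ars} by move=> x h; rewrite sA ?mem_cat ?h ?orbT.
  by case: ifP => _; [apply: IH1|apply: IH2].
- suff loop k : forall s, while_wp k (fun s => eval e s != 0) (wp Z c) Q s ->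
    while_wp k (fun s => eval e s != 0) (wp Z c) (fun s' => frame vs ars s s' /\ Q s') s.
    exact: loop.
  have stop s0 : Q s0 -> frame vs ars s0 s0 /\ Q s0 by split.
  elim: k => [|k IHk] {}s /=; case: ifP => // _; try exact: stop.
  move=> /(IH _ _ sV sA); apply: wp_mono => s1 [F1] /IHk.
  apply: (while_wp_mono (@wp_mono Z c)) => s2 [F2 Q2]; split=> //.
  exact: frame_trans F2.
Qed.

Definition framed (c : cmd) : state -> state -> Prop := frame (set_vars c) (put_arrs c).

Lemma wp_frame Z c Q s : wp Z c Q s -> wp Z c (fun s' => framed c s s' /\ Q s') s.
Proof. exact: wp_frame_sub. Qed.

(** The intermediate state is forgotten except for the postcondition and for what the syntax of the
    first command cannot touch, so specifications need to mention only what changes. *)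
Lemma then_wp Z c1 c2 Q (P : state -> Prop) s :
  wp Z c1 P s ->
  (forall e h, framed c1 s (e, h) -> P (e, h) -> wp Z c2 Q (e, h)) ->
  wp Z (Then c1 c2) Q s.
Proof.
by move=> /wp_frame H1 H2; apply: wp_mono H1 => -[e h] [F Ps]; apply: H2.
Qed.

Section Steps.
Variables (Z : nat) (c : cmd) (Q : state -> Prop) (e : nat -> nat) (h : arr -> nat -> nat).

Lemma nop_wp : Q (e, h) -> wp Z Nop Q (e, h).
Proof. by []. Qed.

Lemma set_wp v x :
  (forall e', e' = upd e v (eval x (e, h)) -> wp Z c Q (e', h)) ->
  wp Z (Then (Assign v x) c) Q (e, h).
Proof. by move=> H; apply: H. Qed.

Lemma put_wp a i x :
  (forall h', h' = put h a (eval i (e, h)) (eval x (e, h)) -> wp Z c Q (e, h')) ->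
  wp Z (Then (Put a i x) c) Q (e, h).
Proof. by move=> H; apply: H. Qed.

Lemma ite_wp x c1 c2 :
  (eval x (e, h) <> 0 -> wp Z c1 Q (e, h)) ->
  (eval x (e, h) = 0 -> wp Z c2 Q (e, h)) -> wp Z (Ite x c1 c2) Q (e, h).
Proof. by move=> H1 H2 /=; case: eqP. Qed.

Lemma loop_wp x b I N :
  N <= Z -> I N (e, h) ->
  (forall k e h, I k (e, h) -> eval x (e, h) <> 0 ->
     exists2 k', k = k'.+1 & wp Z b (I k') (e, h)) ->
  (forall k e h, I k (e, h) -> eval x (e, h) = 0 -> Q (e, h)) ->
  wp Z (Loop x b) Q (e, h).
Proof.
move=> NZ IN step stop; apply: (while_wp_inv (I := I)) IN => //.
- exact: wp_mono.
- by move=> k [e' h'] IkM' /eqP; apply: step.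
- by move=> k [e' h'] IkM' /negPn/eqP; apply: stop IkM'.
Qed.

End Steps.

Arguments nop_wp {Z Q e h} _.
Arguments set_wp {Z c Q e h v x} _.
Arguments put_wp {Z c Q e h a i x} _.
Arguments ite_wp {Z Q e h x c1 c2} _ _.

Opaque wp.

Definition program_of : seq cmd -> cmd := foldr Then Nop.

Definition For (x b : nat) (c : cmd) : cmd :=
  Then (Assign x (Cst 0)) (Loop (Minus (Var b) (Var x))
    (Then c (program_of [:: Assign x (Plus (Var x) (Cst 1))]))).

(** The frame goes back to the state before the loop, so the invariant need not repeat facts about
    what the body leaves alone. The side condition on the counter and the bound is decided by
    computation. *)
Lemma for_wp Z (x b : nat) c N (I : nat -> state -> Prop) e h :
  e b = N -> N <= Z -> [&& x != b, x \notin set_vars c & b \notin set_vars c] ->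
  I 0 (upd e x 0, h) ->
  (forall k e' h', k < N -> e' x = k ->
     frame (x :: set_vars c) (put_arrs c) (e, h) (e', h') -> I k (e', h') ->
     wp Z c (fun s => I k.+1 (upd s.1 x k.+1, s.2)) (e', h')) ->
  wp Z (For x b c) (I N) (e, h).
Proof.
move=> eb NZ /and3P[xb xc bc] I0 step.
refine (set_wp _) => e1 /= E1; rewrite -E1 in I0.
pose J j (s : state) := [/\ j <= N, I (N - j) s, s.1 x = N - j &
  frame (x :: set_vars c) (put_arrs c) (e, h) s].
have bxc : b \notin x :: set_vars c by rewrite inE negb_or eq_sym xb bc.
have xxc : x \in x :: set_vars c by apply: mem_head.
refine (loop_wp (I := J) NZ _ _ _).
- rewrite /J subnn E1 /=; split=> //; first by rewrite -E1.
    exact: upd_same.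
  split=> //= v vx; rewrite upd_other // => ev.
  by move: vx; rewrite ev mem_head.
- move=> j e' h' [jN Ij ex F] /=; have [FV _] := F.
  have eb' : e' b = N by rewrite -eb; apply: (FV b bxc).
  rewrite /= in ex; rewrite eb' ex => jN'.
  have [j' ej] : exists j', j = j'.+1 by exists j.-1; lia.
  exists j' => //.
  have w := step (N - j) e' h' _ ex F Ij.
  refine (then_wp (w _) _) => [|e2 h2 F2 /= I2]; first by lia.
  refine (set_wp _) => e3 /= E3; refine (nop_wp _).
  have e2x : e2 x = N - j by rewrite -ex; apply: (F2.1 x).
  rewrite e2x (_ : N - j + 1 = N - j') in E3; last by lia.
  rewrite E3.
  rewrite (_ : (N - j).+1 = N - j') in I2; last by lia.
  split=> //=; first by lia.
    exact: upd_same.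
  split=> [v vx|a i ai] /=; last exact: etrans (F2.2 _ _ ai) (F.2 _ _ ai).
  rewrite upd_other; last by move=> ev; move: vx; rewrite ev mem_head.
  apply: etrans (F2.1 v _) (F.1 v vx).
  by move: vx; rewrite inE negb_or => /andP[].
- move=> j e' h' [jN Ij ex [FV _]] /=.
  have eb' : e' b = N by rewrite -eb; apply: (FV b bxc).
  rewrite /= in ex; rewrite eb' ex => jN'.
  by move: Ij; rewrite (_ : N - j = N) //; lia.
Qed.

Arguments for_wp {Z x b c N} I {e h} _ _ _ _ _.

Ltac env_at :=
  repeat match goal with
  | H : ?e = upd _ _ _ |- context [?e _] => rewrite H; rewrite /upd /=
  end.

(** * Division by repeated subtraction, and recovery of n and t *)

Notation vB := 0 (only parsing).
Notation vn := 1 (only parsing).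
Notation vt := 2 (only parsing).
Notation vr := 17 (only parsing).
Notation vq := 18 (only parsing).

(** As subtraction is truncated, the guard is nonzero exactly when the divisor is at most the
    current remainder. The number of passes is the quotient. *)
Definition div_mod (d : nat) : cmd := program_of
  [:: Assign vq (Cst 0);
      Loop (Minus (Plus (Var vr) (Cst 1)) (Var d)) (program_of
        [:: Assign vr (Minus (Var vr) (Var d)); Assign vq (Plus (Var vq) (Cst 1))])].

Lemma div_mod_wp Z d e h :
  d \notin [:: vr; vq] -> 0 < e d -> e vr %/ e d <= Z ->
  wp Z (div_mod d) (fun s => s.1 vq = e vr %/ e d /\ s.1 vr = e vr %% e d) (e, h).
Proof.
rewrite !inE negb_or => /andP[/eqP dr /eqP dq].
move Ea: (e vr) => a; move Eb: (e d) => b b0 aZ.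
refine (set_wp _) => e1 /= E1.
pose I k (s : state) := [/\ s.1 d = b, s.1 vr %% b = a %% b, s.1 vr %/ b = k
  & s.1 vq + k = a %/ b].
refine (then_wp (P := fun s => s.1 vq = a %/ b /\ s.1 vr = a %% b) _ _); last first.
  by move=> e2 h2 _ H; refine (nop_wp _).
refine (loop_wp (I := I) aZ _ _ _).
- by split; rewrite /= E1 ?upd_same ?upd_other ?Ea ?Eb.
- move=> k e2 h2 [/= ed er ek eq] /=; rewrite ed => lt.
  have le : b <= e2 vr by lia.
  have k0 : 0 < k by rewrite -ek divn_gt0.
  exists k.-1; first by lia.
  refine (set_wp _) => e3 E3; refine (set_wp _) => e4 E4; refine (nop_wp _).
  have e3r : e3 vr = e2 vr - b by rewrite E3 upd_same /= ed.
  have e2r : e2 vr = e3 vr + b by lia.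
  split; rewrite /= E4.
  + by rewrite upd_other // E3 upd_other.
  + by rewrite upd_other // -er /= e2r modnDr.
  + by rewrite upd_other // -ek /= e2r divnDr // divnn b0 addn1.
  + by rewrite upd_same /= E3 upd_other //= in eq *; lia.
- move=> k e2 h2 [/= ed er ek eq] /=; rewrite ed => lt.
  have lt' : e2 vr < b by lia.
  by move: er ek eq => /=; rewrite modn_small // divn_small // => <- <-; rewrite addn0.
Qed.

Arguments div_mod : simpl never.

(* Every power of two is stripped from (2n+1) 2^(t+5); the last remainder is 1. *)
Definition decode : cmd := program_of
  [:: Assign vr (Var vB); Assign vt (Cst 0); Assign 24 (Cst 2); Assign 25 (Cst 1);
      Loop (Var 25) (program_of
        [:: div_mod 24;
            Ite (Var vr) (program_of [:: Assign 25 (Cst 0); Assign vn (Var vq)])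
              (program_of [:: Assign vr (Var vq); Assign vt (Plus (Var vt) (Cst 1))])]);
      Assign vt (Minus (Var vt) (Cst 5))].

Lemma decode_wp Z n t e h :
  e vB = (2 * n + 1) * 2 ^ (t + 5) -> e vB <= Z ->
  wp Z decode (fun s => s.1 vn = n /\ s.1 vt = t) (e, h).
Proof.
move=> eB BZ.
refine (set_wp _) => e1 /= E1; refine (set_wp _) => e2 /= E2.
refine (set_wp _) => e3 /= E3; refine (set_wp _) => e4 /= E4.
(* While the flag in scalar 25 is up, k - 1 factors 2 are left. The fuel t + 6 is made of t + 5
   halvings and one pass that meets the odd number 2n + 1, whose half is n. *)
pose I k (s : state) := s.1 24 = 2 /\ 
 ([/\ s.1 25 = 1, s.1 vt + k = t + 6, 0 < k, s.1 vr = (2 * n + 1) * 2 ^ k.-1 & s.1 vr <= Z]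
  \/ [/\ s.1 25 = 0, s.1 vn = n & s.1 vt = t + 5]).
refine (then_wp (P := fun s => s.1 vn = n /\ s.1 vt = t + 5) _ _); last first.
  move=> e5 h5 _ [/= en et]; refine (set_wp _) => e6 /= E6; refine (nop_wp _).
  by split=> /=; env_at => //; lia.
refine (loop_wp (I := I) (N := t + 6) _ _ _ _).
- have := ltn_expl t (isT : 1 < 2); move: BZ; rewrite eB expnD; nia.
- split; first by env_at.
  have e4r : e4 vr = e vB by env_at.
  left; split=> /=; rewrite ?e4r ?eB //; try by [env_at|lia].
  by rewrite (addnS t 5).
- move=> k e5 h5 [/= e24 [[e25 ek k0 er rZ]|[-> //]]] _.
  case: k ek k0 er => // k ek _ /= er.
  exists k => //.
  refine (then_wp (div_mod_wp _ (d := 24) _ _ _) _); rewrite ?e24 //.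
    by apply: leq_trans (leq_div _ _) rZ.
  move=> e6 h6 [F _] /= [e6q e6r].
  have e6x v : v \notin [:: vr; vq] -> e6 v = e5 v.
    by move=> hv; apply: F; move: hv; rewrite !inE; lia.
  refine (then_wp (P := I k) _ _); last first.
    by move=> e7 h7 _ H; refine (nop_wp _).
  refine (ite_wp _ _) => /= r0.
    refine (set_wp _) => e7 /= E7; refine (set_wp _) => e8 /= E8; refine (nop_wp _).
    have k0 : k = 0.
      case: k er {ek} => // k er; move: r0; rewrite e6r er expnS.
      by rewrite mulnA [_ * 2]mulnC -mulnA modnMr.
    rewrite {}k0 muln1 in er ek.
    split; first by env_at; rewrite e6x.
    right; split=> /=; env_at => //; last by rewrite e6x //; lia.
    by rewrite e6q er; lia.
  refine (set_wp _) => e7 /= E7; refine (set_wp _) => e8 /= E8; refine (nop_wp _).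
  case: k er ek => [|k] er ek; first by move: r0; rewrite e6r er; lia.
  have qe : e5 vr %/ 2 = (2 * n + 1) * 2 ^ k by rewrite er expnS; lia.
  split; first by env_at; rewrite e6x.
  rewrite qe in e6q.
  left; split=> //=; env_at; rewrite ?e6q ?e6x //; try lia.
- by move=> k e5 h5 [_ [[/= -> //]|[_ en et]]].
Qed.

(** * Listing the group *)

Definition stores (n : nat) (f : nat -> nat) (l : seq {perm 'I_n}) : Prop :=
  forall k (p : 'I_n), k < size l -> f (k * n + p) = nth 1%g l k p.

Lemma stores_eq n f f' (l : seq {perm 'I_n}) :
  f =1 f' -> stores f l -> stores f' l.
Proof. by move=> ff' H k p kl; rewrite -ff' H. Qed.

Lemma stores_rcons n f (l : seq {perm 'I_n}) (x : {perm 'I_n}) :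
  stores f l -> (forall p : 'I_n, f (size l * n + p) = x p) -> stores f (rcons l x).
Proof.
move=> H Hx k p; rewrite size_rcons ltnS leq_eqVlt nth_rcons.
case/orP=> [/eqP->|kl]; first by rewrite ltnn eqxx Hx.
by rewrite kl H.
Qed.

Lemma row_lt n k m p : k < m -> p < n -> k * n + p < m * n.
Proof. nia. Qed.

Notation vm := 3 (only parsing).
Notation vhead := 4 (only parsing).
Notation vho := 5 (only parsing).
Notation vto := 6 (only parsing).
Notation vi := 7 (only parsing).
Notation vxo := 8 (only parsing).
Notation vp := 9 (only parsing).
Notation vfound := 10 (only parsing).
Notation vk := 11 (only parsing).
Notation vko := 12 (only parsing).
Notation vneq := 13 (only parsing).

(** With truncated subtraction this is the absolute difference; it serves as an equality test by
    vanishing. *)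
Definition dist (x y : expr) : expr := Plus (Minus x y) (Minus y x).

Definition compare_rows : cmd := program_of
  [:: Assign vneq (Cst 0);
      For vp vn (program_of [:: Assign vneq (Plus (Var vneq)
        (dist (Get aE (Plus (Var vko) (Var vp))) (Get aE (Plus (Var vto) (Var vp)))))])].

(** The product is written tentatively just behind the list. If it is new, advancing [vm] and [vto]
    turns it into a row; otherwise the next product overwrites it. *)
Definition expand : cmd := program_of
  [:: For vp vn (program_of [:: Put aE (Plus (Var vto) (Var vp))
        (Get aX (Plus (Var vxo) (Get aE (Plus (Var vho) (Var vp)))))]);
      Assign vfound (Cst 0); Assign vko (Cst 0);
      For vk vm (program_of
        [:: compare_rows; Ite (Var vneq) Nop (program_of [:: Assign vfound (Cst 1)]);
            Assign vko (Plus (Var vko) (Var vn))]);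
      Ite (Var vfound) Nop (program_of
        [:: Put aP (Var vm) (Var vhead); Put aG (Var vm) (Var vi);
            Assign vm (Plus (Var vm) (Cst 1)); Assign vto (Plus (Var vto) (Var vn))]);
      Assign vxo (Plus (Var vxo) (Var vn))].

Definition enumerate : cmd := program_of
  [:: For vp vn (program_of [:: Put aE (Var vp) (Var vp)]);
      Assign vm (Cst 1); Assign vhead (Cst 0); Assign vho (Cst 0); Assign vto (Var vn);
      Loop (Minus (Var vm) (Var vhead)) (program_of
        [:: Assign vxo (Cst 0); For vi vt expand;
            Assign vhead (Plus (Var vhead) (Cst 1)); Assign vho (Plus (Var vho) (Var vn))])].

Lemma compare_rows_wp Z e h :
  e vn <= Z ->
  wp Z compare_rows (fun s => s.1 vneq = 0 <->
    forall p, p < e vn -> h aE (e vko + p) = h aE (e vto + p)) (e, h).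
Proof.
move=> nZ; refine (set_wp _) => e1 /= E1.
have e1v v : v != vneq -> e1 v = e v by move=> /eqP hv; rewrite E1 upd_other.
refine (then_wp (for_wp (N := e vn)
  (fun k s => s.1 vneq = 0 <-> forall p, p < k -> h aE (e vko + p) = h aE (e vto + p))
  _ _ _ _ _) _) => //.
- by rewrite e1v.
- by split=> // _; rewrite /= /upd /= E1 /upd.
- move=> k e2 h2 kN e2p [/= FV FA] IH.
  refine (set_wp _) => e3 /= E3; refine (nop_wp _).
  rewrite /= in IH *; rewrite E3 /upd /= e2p (FV vko) // (FV vto) // !e1v // !(FA aE) //.
  split=> [H p|H].
    rewrite ltnS leq_eqVlt => /orP[/eqP->|pk]; first by lia.
    by apply: (IH.1 _ p pk); lia.
  have -> : e2 vneq = 0 by apply/IH => p pk; apply: H; lia.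
  by rewrite H //; lia.
Qed.

Arguments compare_rows : simpl never.

(** A spanning tree of the Cayley graph rooted at the identity. Since parents come earlier, data can
    be propagated along the list in one pass. *)
Definition parents n (P Gn : nat -> nat) (X l : seq {perm 'I_n}) : Prop :=
  forall k, 0 < k < size l ->
    [/\ P k < k, Gn k < size X & nth 1%g l k = (nth 1 l (P k) * nth 1 X (Gn k))%g].

(** The pairs of an element and a generator are treated in lexicographic order, and (hd, i) is the
    next one. *)
Definition enumerated n (X l : seq {perm 'I_n}) (hd i : nat) : Prop :=
  [/\ uniq l, 0 < size l /\ nth 1%g l 0 = 1%g, {subset l <= <<[set x in X]>>%g} &
    forall k j, k < size l -> j < size X -> k < hd \/ k = hd /\ j < i ->
      (nth 1 l k * nth 1 X j)%g \in l].

Definition enum_inv n (X : seq {perm 'I_n}) (hd i : nat) (s : state) : Prop :=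
  exists l : seq {perm 'I_n},
  [/\ [/\ s.1 vn = n, s.1 vt = size X & stores (s.2 aX) X],
      [/\ s.1 vm = size l, s.1 vhead = hd, s.1 vho = hd * n & s.1 vto = size l * n],
      stores (s.2 aE) l, parents (s.2 aP) (s.2 aG) X l & enumerated X l hd i].

Lemma enumerated_size n (X l : seq {perm 'I_n}) hd i :
  enumerated X l hd i -> size l <= #|<<[set x in X]>>%g|.
Proof.
by case=> ul _ lG _; rewrite cardE; apply: uniq_leq_size => // x /lG; rewrite mem_enum.
Qed.

Lemma enumerated_old n (X l : seq {perm 'I_n}) hd i :
  enumerated X l hd i -> hd < size l -> (nth 1 l hd * nth 1 X i)%g \in l ->
  enumerated X l hd i.+1.
Proof.
case=> ul l0 lG lX hl yl; split=> // k j kl jX [kh|[kh]].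
  by apply: lX => //; left.
rewrite ltnS leq_eqVlt => /orP[/eqP->|ji]; first by rewrite kh.
by apply: lX => //; right.
Qed.

Lemma mem_nth_gen n (X : seq {perm 'I_n}) i :
  nth 1%g X i \in <<[set x in X]>>%g.
Proof.
have [iX|iX] := ltnP i (size X); last by rewrite nth_default ?group1.
by rewrite mem_gen // inE mem_nth.
Qed.

Lemma enumerated_new n (X l : seq {perm 'I_n}) hd i :
  enumerated X l hd i -> hd < size l -> (nth 1 l hd * nth 1 X i)%g \notin l ->
  enumerated X (rcons l (nth 1 l hd * nth 1 X i)%g) hd i.+1.
Proof.
set y := (_ * _)%g; case=> ul [l0 l1] lG lX hl yl; split.
- by rewrite rcons_uniq yl.
- by rewrite size_rcons nth_rcons l0.
- move=> x; rewrite mem_rcons inE => /orP[/eqP->|/lG//].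
  by rewrite groupM ?mem_nth_gen ?lG ?mem_nth.
- move=> k j; rewrite size_rcons ltnS => kl jX kj; rewrite mem_rcons inE nth_rcons.
  have {}kl : k < size l by case: kj => [|[-> _]]; lia.
  rewrite kl; case: kj => [kh|[kh]].
    by rewrite lX ?orbT //; left.
  rewrite ltnS leq_eqVlt => /orP[/eqP->|ji]; first by rewrite kh eqxx.
  by rewrite lX ?orbT //; right.
Qed.

Lemma parents_rcons n P Gn P' Gn' (X l : seq {perm 'I_n}) hd i y :
  parents P Gn X l -> (forall k, k < size l -> P' k = P k /\ Gn' k = Gn k) ->
  P' (size l) = hd -> Gn' (size l) = i -> hd < size l -> i < size X ->
  y = (nth 1 l hd * nth 1 X i)%g -> parents P' Gn' X (rcons l y).
Proof.
move=> H PG Ph Gi hl iX ey k; rewrite size_rcons !nth_rcons => /andP[k0].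
rewrite ltnS leq_eqVlt => /orP[/eqP->|kl].
  by rewrite ltnn eqxx Ph Gi hl -ey.
have [-> ->] := PG k kl; rewrite kl.
by have [Pk -> ->] := H k (introT andP (conj k0 kl)); rewrite (ltn_trans Pk kl).
Qed.

Lemma expand_wp Z n (X : seq {perm 'I_n}) hd i e h :
  n <= Z -> #|<<[set x in X]>>%g| <= Z -> i < size X ->
  e vi = i -> e vxo = i * n -> hd < e vm -> enum_inv X hd i (e, h) ->
  wp Z expand (fun s => [/\ s.1 vxo = i.+1 * n, hd < s.1 vm & enum_inv X hd i.+1 s]) (e, h).
Proof.
move=> nZ GZ iX ei exo hm [l [[/= en et sX] [/= em eh eho eto] sE par lP]].
rewrite em in hm; have lZ : size l <= Z by apply: leq_trans (enumerated_size lP) GZ.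
set y := (nth 1 l hd * nth 1 X i)%g.
refine (then_wp (for_wp (N := n) (fun k s =>
    (forall p : 'I_n, p < k -> s.2 aE (size l * n + p) = y p) /\
    (forall x, x < size l * n -> s.2 aE x = h aE x)) en nZ _ _ _) _) => //.
  move=> k e1 h1 kn e1p [/= FV FA] [/= Iy Ix].
  refine (put_wp _) => h2 /= H2; refine (nop_wp _) => /=.
  rewrite e1p (FV vto) // (FV vxo) // (FV vho) // eto exo eho in H2.
  pose k' := Ordinal kn.
  rewrite Ix ?(FA aX) // in H2; last exact: (@row_lt n hd (size l) k).
  rewrite (sE hd k') // (sX i _) // -permM in H2.
  split=> [p|x xl]; rewrite H2 /put /=.
    rewrite ltnS leq_eqVlt eqn_add2l => /orP[/eqP pk|pk].
      by rewrite pk eqxx (_ : p = k') //; apply: val_inj.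
    by rewrite (ltn_eqF pk) Iy.
  by rewrite ltn_eqF ?Ix //; lia.
move=> e1 h1 [/= FV FA] [/= Iy Ix].
have {Iy} Iy (p : 'I_n) : h1 aE (size l * n + p) = y p by apply: Iy.
have sE1 : stores (h1 aE) l by move=> k p kl; rewrite Ix ?sE // row_lt.
refine (set_wp _) => e2 /= E2; refine (set_wp _) => e3 /= E3.
have e3x v : v \notin [:: vp; vfound; vko] -> e3 v = e v.
  rewrite !inE => hv; rewrite E3 upd_other; last by lia.
  by rewrite E2 upd_other ?FV // ?inE; lia.
refine (then_wp (for_wp (N := size l) (fun k s => s.1 vko = k * n /\
    (s.1 vfound = 0 <-> forall k', k' < k -> nth 1%g l k' <> y)) _ lZ _ _ _) _).
- by rewrite e3x.
- by [].
- by rewrite /upd /= E3 /upd /= E2 /upd /=.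
- move=> k e4 h4 kl e4k [/= FV4 FA4] [/= Iko If].
  have e4n : e4 vn = n by rewrite (FV4 vn) // e3x.
  refine (then_wp (compare_rows_wp _ _) _); first by rewrite e4n.
  move=> e5 h5 [/= FV5 FA5] /= e5neq.
  have {}e5neq : e5 vneq = 0 <-> nth 1%g l k = y.
    rewrite e5neq e4n Iko (FV4 vto) // e3x // eto.
    split=> [H|eq p pn]; first apply/permP => p; first apply: val_inj.
      by have := H _ (ltn_ord p); rewrite !(FA4 aE) // sE1 // Iy.
    by rewrite !(FA4 aE) // (sE1 k (Ordinal pn)) // eq -Iy.
  refine (then_wp (P := fun s => s.1 vfound = 0 <->
      (e4 vfound = 0 /\ nth 1%g l k <> y)) _ _).
    refine (ite_wp _ _) => /= e5n.
      refine (nop_wp _) => /=; rewrite (FV5 vfound) //.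
      by split=> [-> | [->]] //; split=> // /e5neq.
    refine (set_wp _) => e6 /= E6; refine (nop_wp _).
    by rewrite /= E6 upd_same; split=> // -[_ []]; apply/e5neq.
  move=> e6 h6 [/= FV6 FA6] /= e6f.
  refine (set_wp _) => e7 /= E7; refine (nop_wp _); split=> /=.
    by rewrite /upd /= E7 /upd /= !FV6 // !FV5 // Iko e4n; lia.
  have -> : upd e7 11 k.+1 vfound = e6 vfound by rewrite /upd /= E7 /upd.
  rewrite e6f If; split=> [[H1 H2] k'|H].
    by rewrite ltnS leq_eqVlt => /orP[/eqP->|/H1].
  by split=> [k' k'k|]; apply: H; lia.
move=> e4 h4 [/= FV4 FA4] [/= _ found].
have {}found : e4 vfound = 0 <-> y \notin l.
  rewrite found; split=> [H|/negP H k' k'l ey]; last by apply: H; rewrite -ey mem_nth.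
  by apply/negP => /(nthP 1%g)[k' k'l]; apply: H.
have e4x v : v \notin [:: vp; vfound; vko; vk; vneq] -> e4 v = e v.
  by rewrite !inE => hv; rewrite FV4 ?e3x // !inE; lia.
have sE4 : stores (h4 aE) l by apply: stores_eq sE1 => x; rewrite (FA4 aE).
have Iy4 (p : 'I_n) : h4 aE (size l * n + p) = y p by rewrite (FA4 aE).
have h4x a x : arr_id a != arr_id aE -> h4 a x = h a x.
  by move=> ha; rewrite FA4 // FA // inE.
refine (then_wp (P := fun s => hd < s.1 vm /\ enum_inv X hd i.+1 s) _ _); last first.
  move=> e5 h5 [/= FV5 FA5] [hm5 [l' [[/= en' et' sX'] [/= em' eh' eho' eto'] sE' par' lP']]].
  refine (set_wp _) => e6 /= E6; refine (nop_wp _).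
  have e6x v : v <> vxo -> e6 v = e5 v by move=> hv; rewrite E6 upd_other.
  split=> /=; last by exists l'; split; rewrite //= !e6x.
    by rewrite E6 upd_same !FV5 // !e4x // exo en; lia.
  by rewrite e6x.
refine (ite_wp _ _) => /= e4f.
  refine (nop_wp _); rewrite /= e4x // em; split=> //.
  exists l; rewrite /= !e4x //; split=> //.
  - by split=> //; apply: stores_eq sX => x; rewrite h4x.
  - by move=> k kl; rewrite !h4x //; apply: par.
  - by apply: enumerated_old => //; apply/negPn/negP => /found.
have yl : y \notin l by apply/found.
refine (put_wp _) => h5 /= H5; refine (put_wp _) => h6 /= H6.
refine (set_wp _) => e5 /= E5; refine (set_wp _) => e6 /= E6; refine (nop_wp _).
have e6x v : v <> vm -> v <> vto -> e6 v = e4 v.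
  by move=> *; rewrite E6 upd_other // E5 upd_other.
have e6m : e6 vm = (size l).+1.
  by rewrite E6 upd_other // E5 upd_same e4x // em addn1.
split; first by rewrite /= e6m; lia.
rewrite e4x // em e4x // eh in H5; rewrite !e4x // em ei in H6.
have h6x a x : arr_id a != arr_id aP -> arr_id a != arr_id aG -> h6 a x = h4 a x.
  by move=> hP hG; rewrite H6 /put (negbTE hG) /= H5 /put (negbTE hP).
have e6h : e6 vto = (size l).+1 * n.
  by rewrite E6 upd_same E5 !upd_other // !e4x // en eto; lia.
exists (rcons l y); rewrite size_rcons /= e6m e6h; split=> //.
- split; rewrite ?e6x // ?e4x //.
  by apply: stores_eq sX => x; rewrite h6x // h4x.
- by split; rewrite ?e6x // ?e4x.
- apply: stores_rcons => [|p]; last by rewrite h6x.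
  by apply: stores_eq sE4 => x; rewrite h6x.
- apply: (parents_rcons par (hd := hd) (i := i)) => // [k kl||].
  + rewrite H6 /put /= (ltn_eqF kl) H5 /put /= (ltn_eqF kl).
    by rewrite !h4x.
  + by rewrite H6 /put /= H5 /put /= eqxx.
  + by rewrite H6 /put /= eqxx.
- exact: enumerated_new.
Qed.

Arguments expand : simpl never.

(** Once the head has reached the end, the list contains 1 and is closed under right multiplication
    by generators, hence contains all words in them. In a finite group these exhaust the generated
    subgroup, inverses included. *)
Lemma enumerated_all n (X l : seq {perm 'I_n}) i :
  enumerated X l (size l) i -> l =i <<[set x in X]>>%g.
Proof.
case=> _ [l0 l1] lG lX x; apply/idP/idP => [/lG//|].
case/gen_prodgP=> k [c cX ->] {x}; elim: k c cX => [|k IH] c cX.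
  by rewrite big_ord0 -l1 mem_nth.
rewrite big_ord_recr /=.
have /(nthP 1%g)[j jl <-] := IH (fun i => c (widen_ord (leqnSn k) i)) (fun _ => cX _).
have := cX ord_max; rewrite inE => /(nthP 1%g)[i' iX <-].
by apply: lX => //; left.
Qed.

Definition listed n (X l : seq {perm 'I_n}) (s : state) : Prop :=
  [/\ [/\ s.1 vn = n, s.1 vt = size X & s.1 vm = size l],
      stores (s.2 aX) X, stores (s.2 aE) l, parents (s.2 aP) (s.2 aG) X l &
      [/\ uniq l, 0 < size l, nth 1%g l 0 = 1%g & l =i <<[set x in X]>>%g]].

Lemma enumerate_wp Z n (X : seq {perm 'I_n}) e h :
  n <= Z -> #|<<[set x in X]>>%g| <= Z -> size X <= Z ->
  e vn = n -> e vt = size X -> stores (h aX) X ->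
  wp Z enumerate (fun s => exists l, listed X l s) (e, h).
Proof.
move=> nZ GZ XZ en et sX.
refine (then_wp (for_wp (N := n) (fun k s =>
    forall p, p < k -> s.2 aE p = p) en nZ _ _ _) _) => //.
  move=> k e1 h1 kn e1p _ /= Ik; refine (put_wp _) => h2 /= H2; refine (nop_wp _) => /=.
  move=> p; rewrite ltnS leq_eqVlt e1p in H2 *; rewrite H2 /put /=.
  by case: eqP => [->//|_ /= /Ik].
move=> e1 h1 [/= FV FA] /= Ip.
refine (set_wp _) => e2 /= E2; refine (set_wp _) => e3 /= E3.
refine (set_wp _) => e4 /= E4; refine (set_wp _) => e5 /= E5.
(* Every pass advances the head, which never exceeds the length of the list and so never exceeds
   |G|. *)
pose I k (s : state) := exists hd, [/\ enum_inv X hd 0 s, hd <= s.1 vm & k + hd = #|<<[set x in X]>>%g|].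
refine (then_wp (P := fun s => exists l, listed X l s) _ _); last first.
  by move=> e6 h6 _ H; refine (nop_wp _).
refine (loop_wp (I := I) GZ _ _ _).
- exists 0; split=> //; last by rewrite addn0.
  exists [:: 1%g] => /=; split=> //.
  + split; env_at; rewrite ?FV //.
    by apply: stores_eq sX => x; rewrite (FA aX).
  + by split; env_at; rewrite ?FV //; lia.
  + move=> k p; rewrite ltnS leqn0 => /eqP->; rewrite mul0n add0n Ip //=.
    by rewrite perm1.
  + by case=> [|k].
  + split=> //=; first by move=> x; rewrite inE => /eqP->; apply: group1.
    by move=> k j _ _ [|[_]].
- move=> k e6 h6 [hd [inv hm khd]] /= lt.
  have {}lt : hd < e6 vm by have [l [_ [/= _ eh _ _] _ _ _]] := inv; lia.
  have k0 : 0 < k.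
    have [l [_ [/= em _ _ _] _ _ lP]] := inv.
    by have := enumerated_size lP; lia.
  exists k.-1; first by lia.
  refine (set_wp _) => e7 /= E7.
  have inv7 : enum_inv X hd 0 (e7, h6).
    have [l [[/= ? ? ?] [/= ? ? ? ?] ? ? ?]] := inv.
    by exists l; split=> //; split=> //=; env_at.
  have lt7 : hd < e7 vm by env_at.
  have e7t : e7 vt = size X by have [l [[]]] := inv7.
  refine (then_wp (for_wp (N := size X) (fun i s =>
    [/\ s.1 vxo = i * n, hd < s.1 vm & enum_inv X hd i s]) e7t XZ _ _ _) _) => //.
  + split=> /=; [by rewrite /upd /= E7 /upd|by rewrite /upd|].
    by have [l [[/= ? ? ?] [/= ? ? ? ?] ? ? ?]] := inv7; exists l.
  + move=> i e8 h8 iX e8i _ [/= xo lt8 inv8].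
    apply: wp_mono (expand_wp nZ GZ iX e8i xo lt8 inv8) => -[e9 h9] [/= xo9 lt9 inv9].
    split=> /=; [by rewrite /upd|by rewrite /upd|].
    by have [l [[/= ? ? ?] [/= ? ? ? ?] ? ? ?]] := inv9; exists l.
  move=> e8 h8 _ [/= _ lt8 [l [[/= en8 et8 sX8] [/= em8 eh8 eho8 eto8] sE8 par8 lP8]]].
  refine (set_wp _) => e9 /= E9; refine (set_wp _) => e10 /= E10; refine (nop_wp _).
  exists hd.+1; split; [|by rewrite /=; env_at|by lia].
  exists l; split=> //=.
  + by split=> //; env_at.
  + by split; env_at => //; rewrite ?eh8 ?eho8 ?en8; lia.
  + case: lP8 => ul l0 lG lX; split=> // k' j k'l jX [k'h|[]//].
    by apply: lX => //; move: k'h; rewrite ltnS leq_eqVlt => /orP[/eqP->|]; [right|left].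
- move=> k e6 h6 [hd [[l [[/= en6 et6 sX6] [/= em6 eh6 eho6 eto6] sE6 par6 lP6]] hm khd]] /=.
  rewrite em6 eh6 => le.
  have ehd : hd = size l by rewrite /= in hm; lia.
  rewrite ehd in lP6; exists l; split=> //.
  have lG := enumerated_all lP6.
  by case: lP6 => ul [l0 l1] _ _; split.
Qed.

(** * Searching the normaliser *)

Notation vR := 14 (only parsing).
Notation vC := 15 (only parsing).
Notation vo := 16 (only parsing).
Notation vacc := 19 (only parsing).
Notation vbad := 20 (only parsing).
Notation vp2 := 21 (only parsing).
Notation vcnt := 22 (only parsing).
Notation vm1 := 23 (only parsing).

(** A single counter with digits in base m replaces t nested loops, since a fixed program has a
    fixed nesting depth while t varies. *)
Definition digit (m i c : nat) : nat := c %/ m ^ i %% m.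

Lemma digit_lt m i c : 0 < m -> digit m i c < m.
Proof. exact: ltn_pmod. Qed.

Lemma digit_surj m t (f : nat -> nat) :
  (forall i, i < t -> f i < m) ->
  exists2 c, c < m ^ t & forall i, i < t -> digit m i c = f i.
Proof.
elim: t f => [|t IH] f fm; first by exists 0.
have [c ct H] := IH (fun i => f i.+1) (fun i it => fm i.+1 it).
have f0 := fm 0 isT; have m0 : 0 < m by lia.
exists (c * m + f 0) => [|[_|i it]]; first by rewrite expnS; nia.
  by rewrite /digit expn0 divn1 modnMDl modn_small.
by rewrite /digit expnS divnMA divnMDl // [f 0 %/ m]divn_small // addn0; apply: H.
Qed.

(** Digits are stored multiplied by n, as offsets of rows of [aE]. The quotient left in [vR] is
    nonzero exactly when the counter has run past the last code. *)
Definition decode_tuple : cmd := program_of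
  [:: Assign vr (Var vC); div_mod vn; Put aQ (Cst 0) (Var vr); Assign vR (Var vq);
      For vi vt (program_of
        [:: Assign vr (Var vR); div_mod vm; Assign vR (Var vq); Assign vacc (Cst 0);
            For 26 vr (program_of [:: Assign vacc (Plus (Var vacc) (Var vn))]);
            Put aD (Var vi) (Var vacc)])].

Lemma decode_tuple_wp Z e h n m t c :
  e vn = n -> e vm = m -> e vt = t -> e vC = c ->
  0 < n -> 0 < m -> m <= Z -> t <= Z -> c <= Z ->
  wp Z decode_tuple (fun s => [/\ s.2 aQ 0 = c %% n,
    forall i, i < t -> s.2 aD i = digit m i (c %/ n) * n &
    s.1 vR = c %/ n %/ m ^ t]) (e, h).
Proof.
move=> en em et ec n0 m0 mZ tZ cZ.
refine (set_wp _) => e1 /= E1.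
refine (then_wp (div_mod_wp _ (d := vn) _ _ _) _) => //; try by env_at; rewrite ?en.
  by env_at; rewrite en ec; apply: leq_trans (leq_div _ _) cZ.
move=> e2 h2 [/= FV FA] [/= e2q e2r].
have {}e2q : e2 vq = c %/ n by rewrite e2q; env_at; rewrite ec en.
have {}e2r : e2 vr = c %% n by rewrite e2r; env_at; rewrite ec en.
have e2x v : v \notin [:: vr; vq] -> e2 v = e v.
  by rewrite !inE => hv; rewrite FV ?E1 ?upd_other // ?inE; lia.
refine (put_wp _) => h3 /= H3; refine (set_wp _) => e3 /= E3.
have e3x v : v \notin [:: vr; vq; vR] -> e3 v = e v.
  by rewrite !inE => hv; rewrite E3 upd_other ?e2x // ?inE; lia.
have e3t : e3 vt = t by rewrite e3x.
refine (then_wp (for_wp (N := t) (fun k s => s.1 vR = c %/ n %/ m ^ k /\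
  forall i, i < k -> s.2 aD i = digit m i (c %/ n) * n) e3t tZ _ _ _) _) => //.
- by split; rewrite // expn0 divn1 /upd /= E3 /upd /=.
- move=> k e4 h4 kt e4k [/= FV4 FA4] [/= e4R ID].
  refine (set_wp _) => e5 /= E5.
  have e5m : e5 vm = m by env_at; rewrite FV4 // e3x.
  have e5r : e5 vr = c %/ n %/ m ^ k by env_at.
  refine (then_wp (div_mod_wp _ (d := vm) _ _ _) _); rewrite ?e5m ?e5r //.
    by do 3 (apply: leq_trans (leq_div _ _) _).
  move=> e6 h6 [/= FV6 FA6] [/= e6q e6r].
  refine (set_wp _) => e7 /= E7; refine (set_wp _) => e8 /= E8.
  have e8r : e8 vr = digit m k (c %/ n) by env_at.
  have e8n : e8 vn = n by env_at; rewrite FV6 // E5 /upd /= FV4 // e3x.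
  refine (then_wp (for_wp (N := digit m k (c %/ n)) (fun j s => s.1 vacc = j * n) e8r _ _ _ _) _).
  + by apply: leq_trans mZ; apply/ltnW/digit_lt.
  + by [].
  + by rewrite /upd /= E8 /upd.
  + move=> j e9 h9 jd e9j [/= FV9 FA9] /= e9a.
    refine (set_wp _) => e10 /= E10; refine (nop_wp _).
    by rewrite /upd /= E10 /upd /= e9a (FV9 vn) // e8n; lia.
  move=> e9 h9 [/= FV9 FA9] /= e9a.
  refine (put_wp _) => h10 /= H10; refine (nop_wp _).
  have e9i : e9 vi = k by rewrite FV9 // E8 /upd /= E7 /upd /= FV6 // E5.
  rewrite e9a e9i in H10.
  split=> [|i]; rewrite /= /upd /=.
    by rewrite FV9 // E8 /upd /= E7 /upd /= e6q expnSr divnMA.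
  rewrite ltnS leq_eqVlt H10 /put /=; case: eqP => [->//|_ /= ik].
  by rewrite (FA9 aD) // (FA6 aD) // ID.
- move=> e4 h4 [/= FV4 FA4] [/= e4R ID]; refine (nop_wp _); split=> //=.
  by rewrite (FA4 aQ) // H3 /put /= e2r.
Qed.

(** The counter c is a code of s. When the group is transitive, at most one s matches a given c; and
    once l lists the group, every normalising s matches some c. *)
Definition matches n' (X l : seq {perm 'I_n'.+1}) (c : nat) (s : {perm 'I_n'.+1}) : Prop :=
  val (s ord0) = c %% n'.+1 /\
  forall i, i < size X -> (nth 1 X i ^ s)%g = nth 1%g l (digit (size l) i (c %/ n'.+1)).

Definition decoded n (l : seq {perm 'I_n}) t c (s : state) : Prop :=
  s.2 aQ 0 = c %% n /\
  forall i, i < t -> s.2 aD i = digit (size l) i (c %/ n) * n.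

(** Entry k of [aQ] is the value of the candidate at the point to which the k-th listed element
    sends 0. *)
Definition build : cmd := program_of
  [:: Put aO (Var vo) (Get aQ (Cst 0)); Assign vko (Var vn);
      For vk vm1 (program_of
       (let k := Plus (Var vk) (Cst 1) in
        [:: Put aQ k (Get aE (Plus (Get aD (Get aG k)) (Get aQ (Get aP k))));
            Put aO (Plus (Var vo) (Get aE (Var vko))) (Get aQ k);
            Assign vko (Plus (Var vko) (Var vn))]))].

(* The value of every candidate at the image of 0 under the k-th element is
   forced by its value at the parent, since conjugation by s commutes with s. *)
Lemma build_wp Z n' (X l : seq {perm 'I_n'.+1}) c o e h :
  [transitive <<[set x in X]>>%g, on [set: 'I_n'.+1] | 'P] ->
  size l <= Z -> listed X l (e, h) -> decoded l (size X) c (e, h) ->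
  e vm1 = (size l).-1 -> e vo = o ->
  wp Z build (fun s => (forall x, x < o -> s.2 aO x = h aO x) /\
    forall p : 'I_n'.+1, exists2 v : 'I_n'.+1, s.2 aO (o + p) = v &
      forall s, matches X l c s -> s p = v) (e, h).
Proof.
move=> tr lZ [[/= en et em] sX sE par [ul l0 l1 lG]] [/= Q0 De] em1 eo.
set n := n'.+1 in en *.
(* This is vacuous if nothing matches c; the row built is then an arbitrary map, to be rejected by
   [check]. *)
pose good (p v : 'I_n) := forall s, matches X l c s -> s p = v.
have c0 : c %% n < n by rewrite ltn_mod.
refine (put_wp _) => h1 /= H1; refine (set_wp _) => e1 /= E1.
rewrite eo in H1.
have e1m : e1 vm1 = (size l).-1 by env_at.
pose I k (s : state) := [/\ s.1 vko = k.+1 * n, forall x, x < o -> s.2 aO x = h aO x &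
  forall k', k' <= k ->
    (exists2 v : 'I_n, good (nth 1%g l k' ord0) v & s.2 aQ k' = v) /\
    (exists2 v : 'I_n, good (nth 1%g l k' ord0) v & s.2 aO (o + nth 1%g l k' ord0) = v)].
refine (then_wp (for_wp (N := (size l).-1) I e1m _ _ _ _) _) => //.
- by lia.
- split=> [|x xo|k']; first by rewrite /= /upd /= E1 /upd /= en mul1n.
    by rewrite H1 /= /put /= ltn_eqF.
  rewrite leqn0 => /eqP->; rewrite l1 perm1.
  have g0 : good ord0 (Ordinal c0) by move=> s [s0 _]; apply: val_inj.
  by split; exists (Ordinal c0); rewrite // H1 /put /= ?addn0 ?eqxx Q0.
- move=> k e2 h2 kl e2k [/= FV FA] [/= ko Ox Ik].
  refine (put_wp _) => h3 /= H3; refine (put_wp _) => h4 /= H4.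
  refine (set_wp _) => e3 /= E3; refine (nop_wp _).
  have k1 : k.+1 < size l by lia.
  have [Pk Gk lk] := par k.+1 k1.
  have h2x a x : arr_id a \notin [:: 5; 6] -> h2 a x = h a x.
    move=> ha; rewrite FA // H1 /put; move: ha; rewrite !inE negb_or => /andP[_].
    by move=> /negbTE->.
  have ePk : h2 aP k.+1 = h aP k.+1 by apply: h2x.
  have eGk : h2 aG k.+1 = h aG k.+1 by apply: h2x.
  rewrite e2k addn1 ePk eGk in H3 H4.
  have [[w wg wQ] _] := Ik _ (Pk : h aP k.+1 <= k).
  set g := h aG k.+1 in Gk lk H3.
  have dl : digit (size l) g (c %/ n) < size l by apply: digit_lt.
  have hD : h2 aD g = digit (size l) g (c %/ n) * n by rewrite h2x // De.
  rewrite wQ hD (h2x aE) // (sE _ w dl) in H3.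
  set d := nth 1%g l (digit _ _ _) in H3.
  have ep : h3 aE (e2 vko) = nth 1%g l k.+1 ord0.
    by rewrite H3 /put /= (h2x aE) // ko -(sE k.+1 ord0) //= addn0.
  rewrite ep (FV vo) // E1 [upd _ _ _ _]/upd /= eo in H4.
  have eQ : h3 aQ k.+1 = d w by rewrite H3 /put /= eqxx.
  rewrite eQ in H4.
  have gd : good (nth 1%g l k.+1 ord0) (d w).
    move=> s ms; have [_ sX'] := ms; rewrite -(wg s ms) /d -sX' // permJ lk.
    by rewrite permM.
  split=> [|x xo|k' k'k] /=.
  + by rewrite /upd /= E3 /upd /= ko (FV vn) // E1 /upd /= en; lia.
  + rewrite H4 /put /= ltn_eqF; last by lia.
    by rewrite H3 /put /= Ox.
  + have {k'k} : k' <= k \/ k' = k.+1 by lia.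
    case=> [k'k|->]; last first.
      by split; exists (d w); rewrite // H4 /put /= ?eqxx ?eQ.
    have [[v vg vQ] [u ug uO]] := Ik k' k'k.
    split; first by exists v => //; rewrite H4 /put /= H3 /put /= ltn_eqF ?vQ.
    (* Several elements may send 0 to the same point, and the last write prevails. This is harmless,
       as every value written is [good] there. *)
    have [->|neqp] := eqVneq (nth 1%g l k' ord0) (nth 1%g l k.+1 ord0).
      by exists (d w) => //; rewrite H4 /put /= eqxx.
    exists u => //; rewrite H4 /put /= eqn_add2l.
    by rewrite (inj_eq val_inj) (negbTE neqp) H3.
- move=> e2 h2 _ [/= _ Ox Ik]; refine (nop_wp _); split=> //= p.
  (* Transitivity ensures that every entry of the row has been written. *)
  have [x xG ->] : exists2 x, x \in <<[set x in X]>>%g & p = x ord0.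
    have : p \in orbit 'P <<[set x in X]>>%g ord0 by rewrite (atransP tr) ?inE.
    by case/imsetP=> x xG ->; exists x.
  have /(nthP 1%g)[k kl <-] : x \in l by rewrite lG.
  have k1 : k <= (size l).-1 by rewrite -ltnS prednK.
  by have [_ [v]] := Ik k k1; exists v.
Qed.

Lemma dist_acc x a b : x + (a - b + (b - a)) = 0 <-> x = 0 /\ a = b.
Proof. lia. Qed.

(** Injectivity needs its own test: a constant map satisfies all the relations when every y_i is
    trivial. *)
Definition check : cmd := program_of
  [:: Assign vbad (Cst 0); Assign vxo (Cst 0);
      For vi vt (program_of
        [:: For vp vn (program_of
              [:: Assign vbad (Plus (Var vbad)
                    (dist (Get aO (Plus (Var vo) (Get aX (Plus (Var vxo) (Var vp)))))
                          (Get aE (Plus (Get aD (Var vi)) (Get aO (Plus (Var vo) (Var vp)))))))]);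
            Assign vxo (Plus (Var vxo) (Var vn))]);
      For vp vn (program_of
        [:: For vp2 vp (program_of
              [:: Ite (dist (Get aO (Plus (Var vo) (Var vp))) (Get aO (Plus (Var vo) (Var vp2))))
                    Nop (program_of [:: Assign vbad (Cst 1)])])])].

Lemma check_wp Z n (X l : seq {perm 'I_n}) c o e h (f : 'I_n -> 'I_n) :
  n <= Z -> size X <= Z -> listed X l (e, h) ->
  (forall i, i < size X -> h aD i = digit (size l) i (c %/ n) * n) -> e vo = o ->
  (forall p : 'I_n, h aO (o + p) = f p) ->
  wp Z check (fun s => s.1 vbad = 0 <->
    (forall i p, i < size X ->
       f (nth 1%g X i p) = nth 1%g l (digit (size l) i (c %/ n)) (f p)) /\ injective f) (e, h).
Proof.
move=> nZ XZ [[/= en et em] sX sE par [ul l0 l1 lG]] De eo Of.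
refine (set_wp _) => e1 /= E1; refine (set_wp _) => e2 /= E2.
have e2t : e2 vt = size X by env_at.
set d := fun i => nth 1%g l (digit (size l) i (c %/ n)).
refine (then_wp (for_wp (N := size X) (fun i s => s.1 vxo = i * n /\
  (s.1 vbad = 0 <-> forall j p, j < i -> f (nth 1%g X j p) = d j (f p))) e2t XZ _ _ _) _) => //.
- by rewrite /upd /= E2 /upd /= E1 /upd /=.
- move=> i e3 h3 iX e3i [/= FV FA] [/= xo bad].
  have e3n : e3 vn = n by rewrite FV // E2 /upd /= E1.
  have e3o : e3 vo = o by rewrite FV // E2 /upd /= E1.
  refine (then_wp (for_wp (N := n) (fun k s => s.1 vbad = 0 <-> e3 vbad = 0 /\
    forall p : 'I_n, p < k -> f (nth 1%g X i p) = d i (f p)) e3n nZ _ _ _) _) => //.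
  + by split=> [/= b0|[]]; first split.
  + move=> k e4 h4 kn e4k [/= FV4 FA4] /= bad4.
    refine (set_wp _) => e5 /= E5; refine (nop_wp _) => /=.
    rewrite [upd _ _ _ _]/upd /= E5 upd_same e4k (FV4 vo) // (FV4 vxo) // (FV4 vi) // e3o xo.
    have hx a x : h4 a x = h a x by rewrite FA4 // FA.
    pose k' := Ordinal kn.
    rewrite !hx (sX i k') // Of e3i De // (Of k') sE; last exact: digit_lt.
    rewrite dist_acc bad4; split=> [[[b0 H2] /val_inj H]|[H1 H2]].
      split=> // p; rewrite ltnS leq_eqVlt => /orP[/eqP pk|/H2//].
      by rewrite (_ : p = k'); last exact: val_inj.
    by split; [split=> // p pk; apply: H2; lia|rewrite H2].
  move=> e4 h4 [/= FV4 FA4] /= bad4; refine (set_wp _) => e5 /= E5; refine (nop_wp _).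
  split=> /=; first by rewrite /upd /= E5 /upd /= FV4 // xo FV4 // e3n; lia.
  rewrite [upd _ _ _ _]/upd /= E5 [upd _ _ _ _]/upd /= bad4 bad.
  split=> [[H1 H2] j p|H].
    by rewrite ltnS leq_eqVlt => /orP[/eqP->|/H1]; first exact: H2.
  by split=> [j p ji|p _]; apply: H; lia.
move=> e3 h3 [/= FV FA] [/= _ bad].
have e3n : e3 vn = n by rewrite FV // E2 /upd /= E1.
have e3o : e3 vo = o by rewrite FV // E2 /upd /= E1.
refine (then_wp (for_wp (N := n) (fun k s => s.1 vbad = 0 <-> e3 vbad = 0 /\
    forall p q : 'I_n, q < p < k -> f p <> f q) e3n nZ _ _ _) _) => //.
- by split=> [/= b0|[]]; first split=> // p q; rewrite ?andbF.
- move=> k e4 h4 kn e4k [/= FV4 FA4] /= bad4.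
  apply: wp_mono (_ : wp Z _ (fun s => s.1 vbad = 0 <-> e4 vbad = 0 /\
    forall q : 'I_n, q < k -> f (Ordinal kn) <> f q) _).
    move=> -[e5 h5] /= bad5; rewrite [upd _ _ _ _]/upd /= bad5 bad4.
    split=> [[[H1 H2] H3]|[H1 H2]].
      split=> // p q /andP[qp]; rewrite ltnS leq_eqVlt => /orP[/eqP pk|pk].
        by rewrite (_ : p = Ordinal kn); [apply: H3; rewrite -pk|apply: val_inj].
      by apply: H2; rewrite qp.
    split=> [|q qk]; last by apply: H2; rewrite /= qk ltnSn.
    by split=> // p q /andP[qp pk]; apply: H2; rewrite qp ltnW.
  have kZ : k <= Z by lia.
  refine (then_wp (for_wp (N := k) (fun j s => s.1 vbad = 0 <-> e4 vbad = 0 /\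
    forall q : 'I_n, q < j -> f (Ordinal kn) <> f q) e4k kZ _ _ _) _) => //.
  + by split=> [/= b0|[]]; first split.
  + move=> j e5 h5 jk e5j [/= FV5 FA5] /= bad5.
    have jn : j < n by lia.
    have hx x : h5 aO x = h aO x by rewrite FA5 // FA4 // FA.
    have Ok : h5 aO (e5 vo + e5 vp) = f (Ordinal kn).
      by rewrite hx -Of FV5 // FV4 // e3o FV5 // e4k.
    have Oj : h5 aO (e5 vo + e5 vp2) = f (Ordinal jn).
      by rewrite hx -Of FV5 // FV4 // e3o e5j.
    refine (then_wp (P := fun s => s.1 vbad = 0 <-> e4 vbad = 0 /\
      forall q : 'I_n, q < j.+1 -> f (Ordinal kn) <> f q) _ _); last first.
      by move=> e6 h6 _ H; refine (nop_wp _) => /=; rewrite /upd.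
    refine (ite_wp _ _) => /=; rewrite Ok Oj => ne.
      refine (nop_wp _) => /=; rewrite bad5; split=> [[b0 H]|[b0 H]]; split=> // q.
        rewrite ltnS leq_eqVlt => /orP[/eqP qj|/H//].
        rewrite (_ : q = Ordinal jn); last exact: val_inj.
        by move=> eqf; apply: ne; rewrite eqf subnn.
      by move=> qj; apply: H; lia.
    refine (set_wp _) => e6 /= E6; refine (nop_wp _) => /=.
    rewrite E6 upd_same; split=> // -[_ /(_ (Ordinal jn) (leqnn _))] [].
    by apply: val_inj => /=; lia.
move=> e4 h4 _ /= bad4; refine (nop_wp _) => /=; rewrite bad4 bad.
split=> [[H1 H2]|[H1 H2]]; split=> //.
- move=> p q eqf; apply/eqP; apply: contraT => ne; exfalso.
  have [pq|qp|/val_inj pq] := ltngtP p q; last by rewrite pq eqxx in ne.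
    by apply: (H2 q p); rewrite ?pq ?ltn_ord.
  by apply: (H2 p q); rewrite ?qp ?ltn_ord.
- by move=> p q /andP[qp _] /H2 eqp; rewrite eqp ltnn in qp.
Qed.

Arguments decode_tuple : simpl never.
Arguments build : simpl never.
Arguments check : simpl never.

(** A row is accepted by advancing [vo] past it; a rejected row is overwritten by the next
    candidate. *)
Definition try_tuple : cmd := program_of
  [:: decode_tuple; build; check;
      Ite (Var vbad) Nop (program_of
        [:: Assign vcnt (Plus (Var vcnt) (Cst 1)); Assign vo (Plus (Var vo) (Var vn))]);
      Assign vC (Plus (Var vC) (Cst 1))].

(* The counter is decoded into an image of 0 and a tuple of elements; the search
   ends once the quotient left after decoding is nonzero. *)
Definition search : cmd := program_of
  [:: Assign vR (Cst 0); Assign vC (Cst 0); Assign vcnt (Cst 0); Assign vo (Cst 1);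
      Assign vm1 (Minus (Var vm) (Cst 1));
      Loop (Minus (Cst 1) (Var vR)) try_tuple;
      Put aO (Cst 0) (Var vcnt); Assign 27 (Cst 8);
      For vp 27 (program_of [:: Put aO (Plus (Var vo) (Var vp)) (Get aO (Var vp))])].

(** By finiteness a conjugate of the group contained in the group equals it, so it suffices to look
    at the conjugates of generators. *)
Lemma norm_gens n (X : seq {perm 'I_n}) s :
  (forall i, i < size X -> (nth 1 X i ^ s)%g \in <<[set x in X]>>%g) ->
  s \in 'N(<<[set x in X]>>)%g.
Proof.
move=> H; rewrite inE -genJ gen_subG; apply/subsetP => _ /imsetP[x xX ->].
by move: xX; rewrite inE => /(nthP 1%g)[i iX <-]; apply: H.
Qed.

Lemma matches_ex n' (X l : seq {perm 'I_n'.+1}) s :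
  l =i <<[set x in X]>>%g -> s \in 'N(<<[set x in X]>>)%g ->
  exists2 c, c < n'.+1 * size l ^ size X & matches X l c s.
Proof.
move=> lG sN; pose f i := index (nth 1 X i ^ s)%g l.
have fP i : (nth 1 X i ^ s)%g \in l by rewrite lG memJ_norm ?mem_nth_gen.
have [c ct ce] := @digit_surj (size l) (size X) f (fun i _ => etrans (index_mem _ _) (fP i)).
have s0 := ltn_ord (s ord0).
exists (c * n'.+1 + s ord0); first by rewrite mulnC; nia.
split=> [|i iX]; first by rewrite modnMDl modn_small.
by rewrite divnMDl // [_ %/ _]divn_small // addn0 ce // nth_index.
Qed.

(** The list Y may repeat an element, so its length is compared with the number of codes tried and
    not with the order of the normaliser. *)
Definition search_inv n' (X l : seq {perm 'I_n'.+1}) (c : nat) (s : state) : Prop :=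
  exists Y : seq {perm 'I_n'.+1},
  [/\ listed X l s,
      [/\ s.1 vC = c, s.1 vcnt = size Y, s.1 vo = (size Y * n'.+1).+1 & s.1 vm1 = (size l).-1],
      stores (fun x => s.2 aO x.+1) Y,
      size Y <= c /\ {subset Y <= 'N(<<[set x in X]>>)%g} &
      forall c' s, c' < c -> matches X l c' s -> s \in Y].

Lemma listed_frame n (X l : seq {perm 'I_n}) e h e' h' :
  e' vn = e vn -> e' vt = e vt -> e' vm = e vm ->
  (forall a x, arr_id a < 4 -> h' a x = h a x) ->
  listed X l (e, h) -> listed X l (e', h').
Proof.
move=> en et em hx [[/= en' et' em'] sX sE par ul]; split=> //=.
- by rewrite en et em.
- by apply: stores_eq sX => x; rewrite hx.
- by apply: stores_eq sE => x; rewrite hx.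
- by move=> k kl; rewrite !hx //; apply: par.
Qed.

Lemma try_tuple_wp Z n' (X l : seq {perm 'I_n'.+1}) c e h :
  [transitive <<[set x in X]>>%g, on [set: 'I_n'.+1] | 'P] ->
  n'.+1 <= Z -> size X <= Z -> size l <= Z -> c <= Z ->
  search_inv X l c (e, h) ->
  wp Z try_tuple (fun s => s.1 vR = c %/ n'.+1 %/ size l ^ size X /\
    search_inv X l c.+1 s) (e, h).
Proof.
set n := n'.+1; move=> tr nZ XZ lZ cZ.
case=> Y [lis [/= eC ecnt eo em1] sY [Yc YN] Ym].
have [[/= en et em] _ _ _ [ul l0 l1 lG]] := lis.
refine (then_wp (decode_tuple_wp (Z := Z) h en em et eC _ _ _ _ _) _) => //.
move=> e1 h1 [/= FV1 FA1] [/= Q0 De eR].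
have lis1 : listed X l (e1, h1).
  by apply: listed_frame lis; rewrite ?FV1 // => a x ha; rewrite FA1 // !inE; lia.
refine (then_wp (build_wp (Z := Z) (c := c) (o := (size Y * n).+1) tr lZ lis1 _ _ _) _);
  rewrite ?FV1 //.
move=> e2 h2 [/= FV2 FA2] [/= Ox Op].
have lis2 : listed X l (e2, h2).
  by apply: listed_frame lis1; rewrite ?FV2 // => a x ha; rewrite FA2 // !inE; lia.
have [f Of fs] : exists2 f : 'I_n -> 'I_n, (forall p : 'I_n, h2 aO ((size Y * n).+1 + p) = f p) &
    forall s, matches X l c s -> forall p, s p = f p.
  exists (fun p : 'I_n => inord (h2 aO ((size Y * n).+1 + p))) => [p|s ms p];
    by have [v -> vs] := Op p; rewrite inord_val ?vs.
have De2 i : i < size X -> h2 aD i = digit (size l) i (c %/ n) * n.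
  by move=> iX; rewrite (FA2 aD) // De.
have eo2 : e2 vo = (size Y * n).+1 by rewrite FV2 // FV1.
refine (then_wp (check_wp nZ XZ lis2 De2 eo2 Of) _).
move=> e3 h3 [/= FV3 FA3] /= bad.
have lis3 : listed X l (e3, h3).
  by apply: listed_frame lis2; rewrite ?FV3 // => a x ha; rewrite FA3 // !inE; lia.
have e3x v : v \in [:: vC; vcnt; vo; vm1; vn] -> e3 v = e v.
  by rewrite !inE => /or4P[|||/orP[]] /eqP->; rewrite FV3 ?FV2 ?FV1.
have e3R : e3 vR = c %/ n %/ size l ^ size X by rewrite FV3 // FV2.
have O3 x : h3 aO x = h2 aO x by rewrite FA3.
have sY3 : stores (fun x => h3 aO x.+1) Y.
  move=> k p kY; rewrite O3 Ox; first by rewrite (FA1 aO) // (sY k).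
  by rewrite ltnS row_lt.
have fin e4 h4 : e4 vC = c -> e4 vR = e3 vR -> search_inv X l c.+1 (upd e4 vC c.+1, h4) ->
    wp Z (program_of [:: Assign vC (Plus (Var vC) (Cst 1))])
     (fun s => s.1 vR = c %/ n %/ size l ^ size X /\ search_inv X l c.+1 s) (e4, h4).
  move=> e4C e4R inv; refine (set_wp _) => e5 /= E5; refine (nop_wp _).
  by rewrite e4C addn1 in E5; rewrite E5; split=> //=; rewrite /upd /= e4R.
refine (then_wp (P := fun s => [/\ s.1 vC = c, s.1 vR = e3 vR &
   search_inv X l c.+1 (upd s.1 vC c.+1, s.2)]) _ _); last first.
  by move=> e4 h4 _ [/= ? ? ?]; apply: fin.
refine (ite_wp _ _) => /= e3bad.
  refine (nop_wp _); split=> //=; first by rewrite e3x.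
  exists Y; split=> /=; [exact: lis3| |by []| |].
  - by split; rewrite /upd /= ?e3x.
  - by split=> //; lia.
  (* A match s of the rejected code would coincide with f, and f would then have passed every
     test. *)
  - move=> c' s; rewrite ltnS leq_eqVlt => /orP[/eqP->|]; last exact: Ym.
    move=> ms; case: e3bad; apply/bad; have sf := fs s ms; split=> [i p iX|].
      by have [_ <- //] := ms; rewrite -!sf permJ.
    by move=> p q; rewrite -!sf => /perm_inj.
have {bad} [fX finj] := bad.1 e3bad.
pose s0 := perm finj.
(* Writing q as the image of a point under [s0] turns the relation tested at that point into
   equality of the two permutations at q. *)
have sX0 i : i < size X -> (nth 1 X i ^ s0)%g = nth 1%g l (digit (size l) i (c %/ n)).
  move=> iX; apply/permP => q; rewrite -[q](permKV s0) permJ.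
  by rewrite ![s0 _]permE fX // -[s0 _]permE permKV.
have s0N : s0 \in 'N(<<[set x in X]>>)%g.
  by apply: norm_gens => i iX; rewrite sX0 // -lG mem_nth // digit_lt.
refine (set_wp _) => e4 /= E4; refine (set_wp _) => e5 /= E5; refine (nop_wp _).
split; [by rewrite /= E5 /upd /= E4 /upd /= e3x|by rewrite /= E5 /upd /= E4|].
exists (rcons Y s0); rewrite size_rcons; split=> /=.
- by apply: listed_frame lis3; rewrite // /upd /= E5 /upd /= E4.
- split; rewrite /upd /= ?E5 /upd /= ?E4 /upd /= ?e3x //; first by lia.
  by rewrite eo en mulSn; lia.
- apply: stores_rcons => // p; rewrite O3 -addSn Of.
  by rewrite permE.
- by split=> [|s]; [lia|rewrite mem_rcons inE => /orP[/eqP->|/YN]].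
- move=> c' s; rewrite ltnS leq_eqVlt mem_rcons inE => /orP[/eqP->|c'c] ms.
    by apply/orP; left; apply/eqP/permP => p; rewrite permE (fs s ms).
  by rewrite (Ym c' s) // orbT.
Qed.

Arguments try_tuple : simpl never.

Lemma search_wp Z n' (X l : seq {perm 'I_n'.+1}) e h :
  [transitive <<[set x in X]>>%g, on [set: 'I_n'.+1] | 'P] ->
  n'.+1 <= Z -> size X <= Z -> size l <= Z -> n'.+1 * size l ^ size X < Z -> 8 <= Z ->
  listed X l (e, h) ->
  wp Z search (fun s => exists Y : seq {perm 'I_n'.+1},
    [/\ Y =i 'N(<<[set x in X]>>)%g, size Y <= (n'.+1 * size l ^ size X).+1,
      s.1 vo = (size Y * n'.+1).+1,
      s.2 aO 0 = size Y /\ stores (fun x => s.2 aO x.+1) Y &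
      forall i, i < 8 -> s.2 aO (s.1 vo + i) = s.2 aO i]) (e, h).
Proof.
set n := n'.+1; set T := n * _; move=> tr nZ XZ lZ TZ Z8 lis.
have [[/= en et em] _ _ _ [ul l0 l1 lG]] := lis.
refine (set_wp _) => e1 /= E1; refine (set_wp _) => e2 /= E2.
refine (set_wp _) => e3 /= E3; refine (set_wp _) => e4 /= E4.
refine (set_wp _) => e5 /= E5.
(* The quotient in [vR] belongs to the code just tried, so the code T is tried too before the loop
   stops. Its digits are those of code 0, whence a possible repetition and the fuel T + 1. *)
pose I k (s : state) := exists c, [/\ search_inv X l c s, c <= T.+1, k + c = T.+1 &
  [/\ s.1 vR = 0 -> c <= T, s.1 vR <> 0 -> T < c & s.1 vn = n]].
refine (then_wp (P := fun s => exists2 c, T < c <= T.+1 & search_inv X l c s) _ _).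
  refine (loop_wp (I := I) (N := T.+1) TZ _ _ _).
  - exists 0; split; rewrite ?addn0 //; last by split=> //; env_at.
    exists [::]; split=> //.
    + by apply: listed_frame lis; env_at.
    + by split; env_at; rewrite ?em ?subn1.
  - move=> k e6 h6 [c [inv cT kc [R0 R1 e6n]]] /= e6R.
    have {}R0 : c <= T by apply: R0; rewrite /=; lia.
    exists k.-1; first by lia.
    have cZ : c <= Z by lia.
    apply: wp_mono (try_tuple_wp tr nZ XZ lZ cZ inv) => s [sR inv'].
    exists c.+1; split; [exact: inv'|by []|by lia|].
    have e0 : s.1 vR = c %/ T by rewrite sR divnMA.
    have T0 : 0 < T by rewrite muln_gt0 expn_gt0 l0.
    split; rewrite ?e0.
    + by move/eqP; rewrite -leqn0 leqNgt divn_gt0 // -ltnNge.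
    + by move/eqP; rewrite -lt0n divn_gt0.
    + by have [Y [[[]]]] := inv'.
  - move=> k e6 h6 [c [inv cT kc [R0 R1 e6n]]] /= e6R.
    by exists c => //; rewrite cT andbT; apply: R1; rewrite /=; lia.
move=> e6 h6 _ [c /andP[Tc cT] [Y [lis6 [/= eC ecnt eo em1] sY [Yc YN] Ym]]].
refine (put_wp _) => h7 /= H7; refine (set_wp _) => e7 /= E7.
have h70 : h7 aO 0 = size Y by rewrite H7 /put /= ecnt.
have h7x x : h7 aO x.+1 = h6 aO x.+1 by rewrite H7.
have e78 : e7 27 = 8 by env_at.
have e7o : e7 vo = (size Y * n).+1 by env_at.
(* The copy runs upwards, so an output of fewer than eight entries is continued periodically and the
   equations still hold. *)
refine (then_wp (for_wp (N := 8) (fun k s =>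
  (forall x, x < (size Y * n).+1 -> s.2 aO x = h7 aO x) /\
  forall i, i < k -> s.2 aO ((size Y * n).+1 + i) = s.2 aO i) e78 Z8 _ _ _) _) => //.
  move=> k e8 h8 k8 e8k [/= FV FA] [/= Ox Oi].
  refine (put_wp _) => h9 /= H9; refine (nop_wp _) => /=.
  rewrite e8k FV // e7o in H9; split=> [x xo|i].
    by rewrite H9 /put /= ltn_eqF ?Ox //; lia.
  rewrite ltnS leq_eqVlt => /orP[/eqP->|ik]; rewrite H9 /put /= ?eqxx.
    by rewrite ltn_eqF //; lia.
  by rewrite !ltn_eqF ?Oi //; lia.
move=> e8 h8 [/= FV FA] [/= Ox Oi]; refine (nop_wp _).
have e8o : e8 vo = (size Y * n).+1 by rewrite FV.
exists Y; rewrite /= e8o; split=> //.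
- move=> s; apply/idP/idP => [/YN//|sN].
  by have [c' c'T ms] := matches_ex lG sN; apply: Ym ms; apply: ltn_trans Tc.
- exact: leq_trans Yc cT.
- split; first by rewrite Ox.
  move=> k p kY; rewrite Ox; first by rewrite h7x (sY k).
  by rewrite ltnS row_lt.
Qed.

(** * The algorithm *)

Definition normaliser_cmd : cmd := Then decode (Then enumerate search).

(* Degree 1 is answered at once, as the time bound is then independent of the
   length of the input. *)
Definition normaliser_code : code :=
  Seq (Const 2 1) (Seq (Sub 0 0 2)
    (If 0 (block [:: Add 0 0 2; boot; cmd_code normaliser_cmd; finish vo]) Skip)).

Lemma nth_enc_input n (X : seq {perm 'I_n}) B k (p : 'I_n) :
  k < size X -> nth 0 (enc_input X B) (3 + (k * n + p)) = nth 1%g X k p.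
Proof.
rewrite /enc_input /=; elim: X k => // x X IH [|k] /= kX.
  rewrite -catA nth_cat size_map size_enum_ord ltn_ord.
  by rewrite (nth_map p) ?size_enum_ord ?ltn_ord // nth_ord_enum.
rewrite -catA nth_cat size_map size_enum_ord ifN -?leqNgt; last by nia.
by rewrite (_ : _ - n = k * n + p) ?IH //; nia.
Qed.

(** If g and h agree on the base, then g h^(-1) fixes it pointwise and is trivial; so the images of
    the base points determine an element. *)
Lemma base_card n (G : {group {perm 'I_n}}) B : is_base G B -> #|G| <= n ^ size B.
Proof.
move=> GB; pose f (g : {perm 'I_n}) := map_tuple (g : 'I_n -> 'I_n) (in_tuple B).
have finj : {in G &, injective f}.
  move=> g h gG hG [/= efgh]; apply/eqP; rewrite eq_mulgV1 -in_set1 -[[set 1%g]]GB.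
  rewrite inE groupM ?groupV //=; apply/astabP => x; rewrite inE /= => xB.
  rewrite /aperm permM; apply: (canLR (permK h)).
  by have /eq_in_map/(_ x xB) := efgh.
rewrite -(card_in_imset finj); apply: leq_trans (max_card _) _.
by rewrite card_tuple card_ord.
Qed.

(** In degree at least 2 there must therefore be a generator and a base point, which makes t b log n
    positive. *)
Lemma trans_nontrivial n' (G : {group {perm 'I_n'.+2}}) :
  [transitive G, on [set: 'I_n'.+2] | 'P] -> G :!=: 1%g.
Proof.
move=> tr; apply/eqP => G1.
have : ord_max \in orbit 'P G (ord0 : 'I_n'.+2) by rewrite (atransP tr) ?inE.
by rewrite G1 => /imsetP[x /set1P->]; rewrite act1.
Qed.

Lemma normaliser_cmd_wp Z n' t (X : seq {perm 'I_n'.+1}) e h :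
  [transitive <<[set x in X]>>%g, on [set: 'I_n'.+1] | 'P] ->
  t = size X -> e vB = (2 * n'.+1 + 1) * 2 ^ (t + 5) -> e vB <= Z ->
  stores (h aX) X -> n'.+1 <= Z -> size X <= Z -> #|<<[set x in X]>>%g| <= Z ->
  n'.+1 * #|<<[set x in X]>>%g| ^ size X < Z -> 8 <= Z ->
  wp Z normaliser_cmd (fun s => exists Y : seq {perm 'I_n'.+1},
    [/\ Y =i 'N(<<[set x in X]>>)%g,
      size Y <= (n'.+1 * #|<<[set x in X]>>%g| ^ size X).+1,
      s.1 vo = (size Y * n'.+1).+1,
      s.2 aO 0 = size Y /\ stores (fun x => s.2 aO x.+1) Y &
      forall i, i < 8 -> s.2 aO (s.1 vo + i) = s.2 aO i]) (e, h).
Proof.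
move=> tr et eB BZ sX nZ XZ GZ TZ Z8.
refine (then_wp (decode_wp h eB BZ) _) => e1 h1 [/= _ FA1] [/= en1 et1].
have sX1 : stores (h1 aX) X by apply: stores_eq sX => x; rewrite (FA1 aX).
rewrite et in et1.
refine (then_wp (enumerate_wp nZ GZ XZ en1 et1 sX1) _) => e2 h2 _ [l lis].
have lG : size l = #|<<[set x in X]>>%g|.
  by have [_ _ _ _ [ul _ _ lG]] := lis; rewrite -(eq_card lG); apply/esym/card_uniqP.
by rewrite -lG in GZ TZ *; apply: search_wp.
Qed.

Lemma normaliser_code_wp Z n' (X : seq {perm 'I_n'.+1}) B :
  [transitive <<[set x in X]>>%g, on [set: 'I_n'.+1] | 'P] ->
  (0 < n' -> [/\ 0 < size X,
    (2 * n'.+1 + 1) * 2 ^ (size X + 5) <= Z, #|<<[set x in X]>>%g| <= Z &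
    ((n'.+1 * #|<<[set x in X]>>%g| ^ size X).+1 * n'.+1).+1 <= Z]) ->
  code_wp Z normaliser_code (fun M => exists2 Y : seq {perm 'I_n'.+1},
    encodes_output M Y & <<[set y in Y]>>%g = 'N(<<[set x in X]>>)%g)
    (fun i => nth 0 (enc_input X B) i).
Proof.
move=> tr H.
refine (const_wp _) => M1 E1; refine (sub_wp _) => M2 E2.
have M20 : M2 0 = n' by rewrite E2 upd_same E1 /upd /= subn1.
refine (if_wp _ _); rewrite M20 => n0; last first.
  (* Degree 1: cell 0 holds n - 1 = 0, which reads as an empty generating list, and every group on
     one point is trivial. *)
  refine (skip_wp _); exists [::]; first by split; rewrite //= M20.
  move: tr {H E1 E2}; rewrite {}n0 in X *; move=> _.
  have S1 (A : {group {perm 'I_1}}) : A = 1%g :> {set _}.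
    apply/trivgP/subsetP => s _; rewrite inE; apply/eqP/permP => i.
    by rewrite !ord1.
  by rewrite (S1 'N(<<[set x in X]>>)%G) (S1 <<[set y in [::]]>>%G).
have n'0 : 0 < n' by lia.
have [X0 bsZ GZ TZ] := H n'0.
set bs := _ * 2 ^ _ in bsZ.
refine (add_wp _) => M3 E3.
have M30 : M3 0 = n'.+1 by rewrite E3 upd_same M20 E2 E1 /upd /= addn1.
have M31 : M3 1 = size X by rewrite E3 E2 E1 !upd_other.
have M32 : M3 2 = 1 by rewrite E3 E2 E1 /upd.
have M3x i : M3 (3 + i) = nth 0 (enc_input X B) (3 + i) by rewrite E3 E2 E1 !upd_other.
refine (seq_wp (boot_wp (erefl bs) M30 M31 M32 isT bsZ) _) => M4 [[e h] r4 [/= eB hX]].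
have t0 : 0 < 2 ^ size X by rewrite expn_gt0.
have bs32 : 32 < bs by rewrite /bs expnD; nia.
have bsX : size X * n'.+1 + 3 <= bs.
  by have := ltn_expl (size X) (isT : 1 < 2); rewrite /bs expnD; nia.
have sX : stores (h aX) X.
  move=> k p kX; have pn := ltn_ord p; rewrite hX; last by have := row_lt kX pn; lia.
  by rewrite M3x; apply: nth_enc_input.
(* The temporaries live below the base address, and computation shows that 32 cells suffice; the
   factor 2^5 in the address guarantees them. *)
have depth : cmd_depth normaliser_cmd < bs by apply: leq_ltn_trans bs32.
set T := _ * _ ^ _ in TZ.
have TZ' : T < Z by nia.
have XZ : size X <= Z by nia.
have nZ : n'.+1 <= Z by nia.
have Z8 : 8 <= Z by lia.
have eBZ : e vB <= Z by rewrite eB.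
refine (seq_wp (cmd_code_wp r4 depth
  (normaliser_cmd_wp tr (erefl _) eB eBZ sX nZ XZ GZ TZ' Z8)) _).
move=> M5 [[e5 h5] r5 [Y [YN YT /= e5o [O0 OY] O8]]].
have oZ : e5 vo <= Z by rewrite e5o; apply: leq_trans TZ; rewrite ltnS leq_mul2r YT orbT.
have bs8 : 8 <= bs by lia.
refine (seq_wp (finish_wp (v := vo) r5 bs8 oZ O8) _) => M6 /= M6O.
refine (skip_wp _); exists Y.
  split=> [|j i jY]; first by rewrite M6O ?O0 // e5o.
  rewrite -addnA M6O; first by rewrite add1n (OY j).
  by rewrite e5o add1n ltnS row_lt.
rewrite (_ : [set y in Y] = 'N(<<[set x in X]>>)%g) ?genGid //.
by apply/setP => y; rewrite inE YN.
Qed.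

(** The three quantities bound the base address, the group order and the length of the output. With
    A = 2^s, each of n, 2^t, m and m^t is at most A, the last because m^t is at most n^(b t). *)
Lemma time_bound s n t b m :
  1 < n -> 0 < t -> 0 < b -> s = t * b * up_log 2 n -> m <= n ^ b ->
  [/\ (2 * n + 1) * 2 ^ (t + 5) <= 2 ^ (10 * s.+1), m <= 2 ^ (10 * s.+1) &
    ((n * m ^ t).+1 * n).+1 <= 2 ^ (10 * s.+1)].
Proof.
move=> n1 t0 b0 es mb.
have nL : n <= 2 ^ up_log 2 n by apply: up_logP.
have L0 : 0 < up_log 2 n by case: (up_log 2 n) nL => //; rewrite expn0; lia.
have ts : t <= s by rewrite es -mulnA leq_pmulr // muln_gt0 b0.
have Ls : up_log 2 n <= s by rewrite es leq_pmull // muln_gt0 t0.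
have bLs : up_log 2 n * b <= s by rewrite es -mulnA [b * _]mulnC leq_pmull.
have nA : n <= 2 ^ s by apply: leq_trans nL _; rewrite leq_exp2l.
have tA : 2 ^ t <= 2 ^ s by rewrite leq_exp2l.
have mL : m <= 2 ^ (up_log 2 n * b).
  by apply: leq_trans mb _; rewrite expnM leq_exp2r.
have mA : m <= 2 ^ s by apply: leq_trans mL _; rewrite leq_exp2l.
have mtA : m ^ t <= 2 ^ s.
  apply: leq_trans (_ : (2 ^ (up_log 2 n * b)) ^ t <= _); first by rewrite leq_exp2r.
  by rewrite -expnM leq_exp2l // es; lia.
(* The quantities are at most 96 A^2, A and A^3 + A + 1, so the constant 10 is generous. Splitting
   off A^3 leaves [nia] only products of the bounds just proved. *)
have -> : 2 ^ (10 * s.+1) = 1024 * (2 ^ s * 2 ^ s * 2 ^ s * 2 ^ (7 * s)).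
  by rewrite -!expnD (_ : 1024 = 2 ^ 10) // -expnD; congr (2 ^ _); lia.
rewrite expnD.
have A7 : 0 < 2 ^ (7 * s) by rewrite expn_gt0.
have A1 : 0 < 2 ^ s by rewrite expn_gt0.
move: (2 ^ s) (2 ^ (7 * s)) (2 ^ t) (m ^ t) nA tA mA mtA A7 A1 => A A' T U.
move=> nA tA mA mtA A7 A1.
have AA : A <= A * A by nia.
have AAA : A * A <= A * A * A by nia.
have AA' : A * A * A <= A * A * A * A' by nia.
have nT : n * T <= A * A by apply: leq_mul.
have nU : n * U * n <= A * A * A by apply: leq_mul => //; apply: leq_mul.
by split; nia.
Qed.

Local Open Scope group_scope.

Theorem theorem3p3 :
  exists (P : program) (c : nat),
    forall (n : nat) (X : seq {perm 'I_n}) (B : seq 'I_n),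
      [transitive <<[set x in X]>>, on [set: 'I_n] | 'P] ->
      is_base <<[set x in X]>> B ->
      exists (k : nat) (cf : config) (Y : seq {perm 'I_n}),
        [/\ (k <= 2 ^ (c * (size X * size B * up_log 2 n).+1))%N,
            run P k (init_config (enc_input X B)) = Some cf,
            encodes_output (memory cf) Y &
            <<[set y in Y]>> = 'N(<<[set x in X]>>)].
Proof.
exists (compile 0 normaliser_code), (10 * rank normaliser_code)%N.
move=> n X B tr GB; set s := (size X * size B * _)%N.
(* Transitivity asks the set to be the orbit of one of its points, which excludes degree 0. *)
case: n => [|n'] in X B tr GB s *; first by case/imsetP: tr => -[].
(* The successor in the exponent matters here: in degree 1 the logarithm, and hence s, is 0. *)
have Z3 : (3 < 2 ^ (10 * s.+1))%N.
  by apply: leq_trans (_ : 2 ^ 10 <= _)%N => //; rewrite leq_exp2l //; lia.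
have [|k [cf [lek rk [Y eY NY]]]] := code_run Z3 (@normaliser_code_wp (2 ^ (10 * s.+1)) _ X B tr _).
  case: n' => // n' in X B tr GB s Z3 * => _.
  have G1 := trans_nontrivial tr.
  have X0 : (0 < size X)%N.
    case: (X) G1 => // /eqP[]; apply/trivgP; rewrite gen_subG.
    by apply/subsetP => x; rewrite inE.
  have B0 : (0 < size B)%N.
    (* The stabiliser of the empty sequence is the whole group, so an empty base would make the
       group trivial. *)
    case: (B) GB => //= GB; move: G1; rewrite -GB; case/eqP.
    apply/esym/setIidPl/subsetP => g _; apply/astabP => x.
    by rewrite inE.
  by have [? ? ?] := time_bound (isT : 1 < n'.+2)%N X0 B0 (erefl s) (base_card GB).
exists k, cf, Y; split=> //; apply: leq_trans lek _.
by rewrite -expnM leq_exp2l //; lia.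
Qed.
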